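(* Let $n\geq r\geq 1$ be integers and let $\operatorname{SO}(r)$ act on $\mathbb R^{r\times n}$ by left matrix multiplication. Let $\phi(X)=\sqrt{X^TX}\in\mathbb R^{n\times n}$ (positive semidefinite square root) and let $\psi(X)\in\mathbb R^{\binom nr}$ be the scaled Plücker invariant of $X\in\mathbb R^{r\times n}$. The map $F\colon\mathbb R^{r\times n}/\operatorname{SO}(r)\to\mathbb R^{n\times n}\times\mathbb R^{\binom nr}$ defined by $$F([X])=\big(\phi(X),\ \sqrt2\cdot\psi(X)\big)$$ has distortion $\kappa(F)\leq2\sqrt2$. Moreover, for all $n\geq r\geq2$, $$\sqrt2\leq c_2\big(\mathbb R^{r\times n}/\operatorname{SO}(r)\big)\leq2\sqrt2.$$
   Context: Plücker coordinates: for $X\in\mathbb R^{r\times n}$, $\operatorname{Plu}(X)\in\mathbb R^{\binom nr}$ is the vector of determinants of all $r\times r$ submatrices of $X$ (indexed by $r$-element sets of columns). Scaled Plücker invariant: given $X\in\mathbb R^{r\times n}$ with $n\ge r$, take any thin singular value decomposition $X=U_X\Sigma_XV_X$ with $U_X\in\operatorname{SO}(r)$, $\Sigma_X$ the $r\times r$ diagonal matrix of singular values of $X$ in nonincreasing order, and $V_X\in\mathbb R^{r\times n}$ with $V_XV_X^T=\operatorname{Id}_r$. Then $\psi(X):=\sigma_{\min}(X)\cdot\operatorname{Plu}(V_X)$, where $\sigma_{\min}(X)$ is the smallest (i.e. $r$th largest) singular value of $X$; this is well defined and $\operatorname{SO}(r)$-invariant. $\mathbb R^{r\times n}$ and $\mathbb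 R^{n\times n}$ carry the Frobenius norm, and $\mathbb R^{r\times n}/\operatorname{SO}(r)$ carries the quotient metric $d([X],[Y])=\min_{Q\in\operatorname{SO}(r)}\|QX-Y\|_F$. The codomain of $F$ carries the product Euclidean norm. For a map $f\colon X\to Y$ of metric spaces, let $\alpha,\beta\in[0,\infty]$ be the largest and smallest constants (respectively) with $\alpha\, d_X(x,x')\le d_Y(f(x),f(x'))\le\beta\, d_X(x,x')$ for all $x,x'\in X$; the distortion of $f$ is $\kappa(f):=\beta/\alpha$, with $\kappa(f)=\infty$ if $\alpha=0$ or $\beta=\infty$. The Euclidean distortion $c_2(X)\in[1,\infty]$ is the infimum of all $c$ for which there exist a Hilbert space $H$ and a map $f\colon X\to H$ with $\kappa(f)=c$. *)

(* Defs.v *)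
From HB Require Import structures.
From mathcomp Require Import all_boot all_order all_algebra.
From mathcomp Require Import sesquilinear.
From mathcomp Require Import all_classical all_reals all_analysis.
Set Implicit Arguments.
Unset Strict Implicit.
Unset Printing Implicit Defensive.
Import Order.TTheory GRing.Theory Num.Theory.
Import numFieldNormedType.Exports.
Local Open Scope classical_set_scope.
Local Open Scope ring_scope.
Local Open Scope quotient_scope.

Section Distortion.
Variable R : realType.

Section Maps.
(* X and Y are metric spaces with distances dX and dY. *)
Variables (X Y : Type) (dX : X -> X -> R) (dY : Y -> Y -> R) (f : X -> Y).

(* The constants range over [0, +oo]; recall that +oo * 0 = 0 in \bar R. *)
Definition lower_lip : \bar R :=
  ereal_sup [set a : \bar R | (0 <= a)%E /\
    forall x x', (a * (dX x x')%:E <= (dY (f x) (f x'))%:E)%E].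

Definition upper_lip : \bar R :=
  ereal_inf [set b : \bar R | (0 <= b)%E /\
    forall x x', ((dY (f x) (f x'))%:E <= b * (dX x x')%:E)%E].

Definition distortion : \bar R :=
  if (lower_lip == 0%E) || (upper_lip == +oo%E) then +oo%E
  else (upper_lip / lower_lip)%E.

End Maps.

(* A real Hilbert space is a complete normed module whose norm comes from a
   positive definite symmetric bilinear form. *)
Definition euclidean_distortion (X : Type) (dX : X -> X -> R) : \bar R :=
  ereal_inf [set c : \bar R |
    exists (H : completeNormedModType R) (ip : {dot H for idfun}) (f : X -> H),
      (forall u : H, ip u u = `|u| ^+ 2) /\
      distortion dX (fun u v : H => `|u - v|) f = c].

End Distortion.

Section Orbits.
Variables (R : realType) (r n : nat).
Implicit Types (X Y : 'M[R]_(r, n)) (Q : 'M[R]_r).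

Definition frob (p q : nat) (A : 'M[R]_(p, q)) : R :=
  Num.sqrt (\sum_i \sum_j A i j ^+ 2).

Definition SO : set 'M[R]_r := [set Q | Q *m Q^T = 1%:M /\ \det Q = 1].

Lemma SO1 : SO 1%:M.
Proof. by split; rewrite ?trmx1 ?mulmx1 ?det1. Qed.

Lemma SOM P Q : SO P -> SO Q -> SO (P *m Q).
Proof.
move=> [P1 P2] [Q1 Q2]; split; last by rewrite det_mulmx P2 Q2 mulr1.
by rewrite trmx_mul mulmxA -(mulmxA P) Q1 mulmx1.
Qed.

Lemma SOT Q : SO Q -> SO Q^T.
Proof. by move=> [/mulmx1C Q1 Q2]; split; rewrite ?trmxK ?det_tr. Qed.

Definition SO_rel X Y : bool := `[< exists2 Q, SO Q & Y = Q *m X >].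

Lemma SO_rel_equiv : equiv_class_of SO_rel.
Proof.
split.
- by move=> X; apply/asboolP; exists 1%:M; [exact: SO1 | rewrite mul1mx].
- move=> X Y; apply/asboolP/asboolP => -[Q QSO ->]; exists Q^T;
    by [exact: SOT | rewrite mulmxA (mulmx1C QSO.1) mul1mx].
- move=> Y X Z /asboolP[P PSO ->] /asboolP[Q QSO ->]; apply/asboolP.
  by exists (Q *m P); [exact: SOM | rewrite mulmxA].
Qed.

Canonical SO_equiv := EquivRelPack SO_rel_equiv.

Definition SO_quot := {eq_quot SO_equiv}.

(* SO(r) is compact, so this infimum is a minimum. *)
Definition quot_dist (a b : SO_quot) : R :=
  inf [set frob (Q *m repr a - repr b) | Q in SO].

Definition psdmx (m : nat) (B : 'M[R]_m) : Prop :=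
  B^T = B /\ forall v : 'rV[R]_m, 0 <= (v *m B *m v^T) 0 0.

Definition psd_sqrt (m : nat) (A : 'M[R]_m) : 'M[R]_m :=
  xget 0 [set B | psdmx B /\ B *m B = A].

Definition phi X : 'M[R]_n := psd_sqrt (X^T *m X).

Definition colset : Type := {S : {set 'I_n} | #|S| == r}.

(* [enum_val] lists the columns in S in increasing order. *)
Definition cols_of (S : colset) (i : 'I_r) : 'I_n :=
  enum_val (cast_ord (esym (eqP (valP S))) i).

Definition plucker X : {ffun colset -> R} :=
  [ffun S => \det (colsub (cols_of S) X)].

(* X = U diag(s) V; the factor V is r x n and is not transposed. *)
Definition thin_svd X (U : 'M[R]_r) (s : 'rV[R]_r) (V : 'M[R]_(r, n)) : Prop :=
  [/\ SO U,
      (forall i, 0 <= s 0 i),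
      (forall i j : 'I_r, (i <= j)%N -> s 0 j <= s 0 i),
      V *m V^T = 1%:M &
      X = U *m diag_mx s *m V].

Definition sigma_min (s : 'rV[R]_r) : R := last 0 [seq s 0 i | i : 'I_r].

(* The set below is a singleton when 1 <= r <= n: the value does not depend on
   the decomposition. *)
Definition psi X : {ffun colset -> R} :=
  xget 0 [set p | exists U s V,
    thin_svd X U s V /\ p = sigma_min s *: plucker V].

Definition F (a : SO_quot) : 'M[R]_n * {ffun colset -> R} :=
  (phi (repr a), Num.sqrt 2 *: psi (repr a)).

Definition cod_dist (y z : 'M[R]_n * {ffun colset -> R}) : R :=
  Num.sqrt (frob (y.1 - z.1) ^+ 2 + \sum_S (y.2 S - z.2 S) ^+ 2).

Lemma repr_SO_quot X : exists2 Q, SO Q & repr (\pi_SO_quot X) = Q *m X.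
Proof.
have /eqmodP/asboolP[Q QSO E] : X = repr (\pi_SO_quot X) %[mod SO_quot].
  by rewrite reprK.
by exists Q.
Qed.

Lemma frob_SO (q : nat) Q (A : 'M[R]_(r, q)) : SO Q -> frob (Q *m A) = frob A.
Proof.
have frobE (B : 'M[R]_(r, q)) : frob B = Num.sqrt (\tr (B^T *m B)).
  rewrite /frob exchange_big; congr Num.sqrt; apply: eq_bigr => j _.
  by rewrite mxE; apply: eq_bigr => i _; rewrite mxE expr2.
move=> [/mulmx1C QQ _].
by rewrite !frobE trmx_mul mulmxA -(mulmxA A^T) QQ mulmx1.
Qed.

Lemma quot_dist_pi X Y :
  quot_dist (\pi_SO_quot X) (\pi_SO_quot Y) =
  inf [set frob (Q *m X - Y) | Q in SO].
Proof.
have [P PSO EX] := repr_SO_quot X; have [P' P'SO EY] := repr_SO_quot Y.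
rewrite /quot_dist EX EY; congr inf; apply/seteqP; split => _ [Q QSO <-] /=.
- exists (P'^T *m Q *m P); first by do 2?apply: SOM => //; exact: SOT.
  rewrite -[LHS](frob_SO _ P'SO); congr frob; rewrite !mulmxBr !mulmxA.
  by rewrite P'SO.1 mul1mx.
- exists (P' *m Q *m P^T); first by do 2?apply: SOM => //; exact: SOT.
  rewrite -[RHS](frob_SO _ P'SO) mulmxBr !mulmxA -(mulmxA _ P^T).
  by rewrite (mulmx1C PSO.1) mulmx1.
Qed.

Lemma phi_SO Q X : SO Q -> phi (Q *m X) = phi X.
Proof.
by move=> [/mulmx1C QQ _]; rewrite /phi trmx_mul mulmxA -(mulmxA X^T) QQ mulmx1.
Qed.

Lemma psi_SO Q X : SO Q -> psi (Q *m X) = psi X.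
Proof.
suff sub P Y p : SO P ->
    (exists U s V, thin_svd Y U s V /\ p = sigma_min s *: plucker V) ->
    exists U s V, thin_svd (P *m Y) U s V /\ p = sigma_min s *: plucker V.
  move=> QSO; congr xget; apply/seteqP; split => p /=; last exact: sub.
  by move=> /(sub _ _ _ (SOT QSO)); rewrite mulmxA (mulmx1C QSO.1) mul1mx.
move=> PSO [U [s [V [[USO s0 sd V1 YE] pE]]]]; exists (P *m U), s, V.
by split=> //; split=> //; [exact: SOM | rewrite YE !mulmxA].
Qed.

Lemma F_pi X : F (\pi_SO_quot X) = (phi X, Num.sqrt 2 *: psi X).
Proof.
by have [Q QSO E] := repr_SO_quot X; rewrite /F E phi_SO ?psi_SO.
Qed.

End Orbits.

(* Main.v *)
(* Write X = U S V and Y = U' T V' (thin SVDs), O = U^T U' and W = V V'^T, and let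
   a, b be the smallest singular values. Then
     |X - Y|^2 = sum s_i^2 + sum t_j^2 - 2 sum s_i t_j O_ij W_ij,
   |phi X - phi Y|^2 is the same expression with W_ij^2 in place of O_ij W_ij, and
   |psi X - psi Y|^2 = a^2 + b^2 - 2 a b det W by Cauchy-Binet.
   Upper bound: phi is sqrt 2-Lipschitz since O is orthogonal, and psi is
   1-Lipschitz since tr(O^T W) <= r - 1 + det W; hence F is 2-Lipschitz.
   Lower bound: if det W >= 0, aligning X and Y by the polar factor of S W T gives
   d(X, Y) <= |phi X - phi Y|. If det W < 0, first negate the smallest singular
   direction of X or of Y, which moves that matrix by 2 min(a, b), while
   |psi X - psi Y|^2 >= a^2 + b^2. Either way d(X, Y)^2 <= 2 |F X - F Y|^2.
   Bound on c_2: the matrices e_1 v^T form an isometric copy of R^n / {+1, -1}, and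
   in it the unit circle is a loop of length pi whose opposite points are at
   distance sqrt 2. In a Hilbert space, a discrete Wirtinger inequality on regular
   2^k-gons bounds opposite distances by adjacent ones. *)
Require Import Defs.
From HB Require Import structures.
From mathcomp Require Import all_fingroup.
From mathcomp Require Import all_boot all_order all_algebra.
From mathcomp Require Import sesquilinear ring lra zify.
From mathcomp Require Import all_classical all_reals all_analysis.
Set Implicit Arguments.
Unset Strict Implicit.
Unset Printing Implicit Defensive.
Import Order.TTheory GRing.Theory Num.Theory.
Import numFieldNormedType.Exports.
Local Open Scope ring_scope.

(** * Euclidean spaces *)

Section FiniteEuclidean.
Local Open Scope classical_set_scope.
Variables (R : realType) (I : finType).
Implicit Types u v : {ffun I -> R}.

Definition ffdot u v : R := \sum_i u i * v i.
Definition ffnorm u : R := Num.sqrt (ffdot u u).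

Lemma ffdotC u v : ffdot u v = ffdot v u.
Proof. by apply: eq_bigr => i _; rewrite mulrC. Qed.

Lemma ffdot_linear u : GRing.linear_for *%R (ffdot u).
Proof.
move=> a v w; rewrite /ffdot mulr_sumr -big_split; apply: eq_bigr => i _ /=.
by rewrite !ffunE mulrDr mulrCA.
Qed.

Lemma ffdot_ge0 u : 0 <= ffdot u u.
Proof. by apply: sumr_ge0 => i _; rewrite -expr2 sqr_ge0. Qed.

Lemma ffnorm_sqr u : ffnorm u ^+ 2 = ffdot u u.
Proof. by rewrite sqr_sqrtr ?ffdot_ge0. Qed.

Lemma ler_coord_ffnorm u i : `|u i| <= ffnorm u.
Proof.
rewrite -sqrtr_sqr ler_wsqrtr// /ffdot (bigD1 i)//= expr2 lerDl.
by apply: sumr_ge0 => j _; rewrite -expr2 sqr_ge0.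
Qed.

Lemma ffnorm_eq0 u : ffnorm u = 0 -> u = 0.
Proof.
move=> u0; apply/ffunP => i; rewrite ffunE; apply/eqP.
by rewrite -normr_le0 -u0 ler_coord_ffnorm.
Qed.

Lemma ffnormZ (a : R) u : ffnorm (a *: u) = `|a| * ffnorm u.
Proof.
rewrite /ffnorm -[`|a|]sqrtr_sqr -sqrtrM ?sqr_ge0//; congr Num.sqrt.
rewrite /ffdot mulr_sumr; apply: eq_bigr => i _; rewrite ffunE /=.
by rewrite /GRing.scale/=; ring.
Qed.

(** Cauchy-Schwarz: with a and b the norms of u and v, the squared norm of b u - a v equals 2ab(ab -
    <u, v>), which can be divided by ab once both norms are nonzero. *)
Lemma ffdot_le_norm u v : ffdot u v <= ffnorm u * ffnorm v.
Proof.
have [/ffnorm_eq0->|u0] := eqVneq (ffnorm u) 0.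
  rewrite /ffdot big1 ?mulr_ge0 ?sqrtr_ge0// => i _.
  by rewrite ffunE mul0r.
have [/ffnorm_eq0->|v0] := eqVneq (ffnorm v) 0.
  rewrite /ffdot big1 ?mulr_ge0 ?sqrtr_ge0// => i _.
  by rewrite ffunE mulr0.
have u_gt0 : 0 < ffnorm u by rewrite lt_def u0 sqrtr_ge0.
have v_gt0 : 0 < ffnorm v by rewrite lt_def v0 sqrtr_ge0.
set a := ffnorm u in u_gt0 u0 *; set b := ffnorm v in v_gt0 v0 *.
have : 0 <= \sum_i (b * u i - a * v i) ^+ 2.
  by apply: sumr_ge0 => i _; rewrite sqr_ge0.
have -> : \sum_i (b * u i - a * v i) ^+ 2 =
    b ^+ 2 * ffdot u u + a ^+ 2 * ffdot v v - 2 * a * b * ffdot u v.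
  rewrite /ffdot !mulr_sumr -big_split/= -sumrB; apply: eq_bigr => i _.
  by ring.
rewrite -!ffnorm_sqr -/a -/b => H.
have ab : 0 < a * b by rewrite mulr_gt0.
have : 0 <= (2 * (a * b)) * (a * b - ffdot u v) by nra.
by rewrite pmulr_rge0 ?mulr_gt0// subr_ge0.
Qed.

Lemma ler_ffnormD u v : ffnorm (u + v) <= ffnorm u + ffnorm v.
Proof.
rewrite -(ler_pXn2r (n := 2)) ?nnegrE ?addr_ge0 ?sqrtr_ge0//.
have -> : ffnorm (u + v) ^+ 2 = ffdot u u + ffdot v v + 2 * ffdot u v.
  rewrite ffnorm_sqr /ffdot mulr_sumr -!big_split; apply: eq_bigr => i _ /=.
  by rewrite !ffunE; ring.
rewrite sqrrD !ffnorm_sqr; have := ffdot_le_norm u v.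
by rewrite -mulr_natr; lra.
Qed.

Lemma ffnorm_le_sum u : ffnorm u <= \sum_i `|u i|.
Proof.
rewrite -[leRHS]ger0_norm ?sumr_ge0// -sqrtr_sqr ler_wsqrtr//.
rewrite expr2 mulr_suml; apply: ler_sum => i _.
rewrite -expr2 -real_normK ?num_real// expr2 ler_wpM2l//.
by rewrite (bigD1 i)//= lerDl sumr_ge0.
Qed.

(** The alias inherits the module structure and carries the Euclidean norm; it is the Hilbert space
    that witnesses the upper bound on c_2. *)
Definition euclid : Type := {ffun I -> R}.

HB.instance Definition _ := GRing.Lmodule.on euclid.
HB.instance Definition _ :=
  @Lmodule_isNormed.Build R euclid ffnorm ler_ffnormD ffnormZ ffnorm_eq0.

Lemma euclid_complete (F : set_system euclid) :
  ProperFilter F -> cauchy F -> cvg F.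
Proof.
move=> FF /cauchy_ballP F_cauchy.
have coordF i : cvg ((fun u : euclid => (u : {ffun I -> R}) i) @ F).
  apply: cauchy_cvg; apply/cauchy_ballP => e e0; rewrite near_simpl.
  apply: filterS (F_cauchy e e0) => -[u v] /=.
  rewrite -!ball_normE /= => uv; apply: le_lt_trans uv.
  by have := ler_coord_ffnorm ((u : {ffun I -> R}) - v) i; rewrite !ffunE.
pose l : euclid := [ffun i => lim ((fun u : euclid => (u : {ffun I -> R}) i) @ F)].
apply/cvg_ex; exists l; apply/cvgrPdist_le => e e0.
(* Coordinatewise closeness is summed over [I]; the successor keeps the denominator nonzero when [I]
   is empty. *)
have : \forall u \near F, forall i, `|l i - (u : {ffun I -> R}) i| <= e / (#|I|.+1)%:R.
  apply: filter_forall => i; rewrite ffunE.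
  have e1 : 0 < e / (#|I|.+1)%:R by rewrite divr_gt0 ?ltr0n.
  exact: (@cvgrPdist_le _ _ _ _ _ _ _).1 (coordF i) _ e1.
apply: filterS => u ule.
apply: le_trans (ffnorm_le_sum _) _.
apply: le_trans (_ : \sum_(i : I) e / (#|I|.+1)%:R <= _).
  by apply: ler_sum => i _; have := ule i; rewrite !ffunE.
rewrite sumr_const -(mulr_natr (e / _)) -mulrA ler_piMr ?(ltW e0)//.
by rewrite mulrC ler_pdivrMr ?mul1r ?ler_nat ?ltr0n.
Qed.

HB.instance Definition _ := Uniform_isComplete.Build euclid euclid_complete.

Definition euclid_dot (u v : euclid) : R := ffdot u v.

Lemma euclid_dot_bilinear : bilinear_for
  (GRing.Scale.Law.clone _ _ *%R _)
  (GRing.Scale.Law.clone _ _ ((idfun : {rmorphism R -> R}) \; *%R) _) euclid_dot.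
Proof.
split=> u a v w; rewrite /euclid_dot; last exact: ffdot_linear.
by rewrite /applyr ffdotC [in RHS]ffdotC [ffdot w u]ffdotC ffdot_linear.
Qed.

HB.instance Definition _ := bilinear_isBilinear.Build R euclid euclid R
  (GRing.Scale.Law.clone _ _ *%R _)
  (GRing.Scale.Law.clone _ _ ((idfun : {rmorphism R -> R}) \; *%R) _)
  euclid_dot euclid_dot_bilinear.

Lemma euclid_dot_hermitian u v :
  euclid_dot u v = (-1) ^+ false * idfun (euclid_dot v u).
Proof. by rewrite expr0 mul1r /euclid_dot ffdotC. Qed.

HB.instance Definition _ := isHermitianSesquilinear.Build R euclid false idfun
  euclid_dot euclid_dot_hermitian.

Lemma euclid_dot_gt0 (u : euclid) : u != 0 -> 0 < euclid_dot u u.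
Proof.
move=> u0; rewrite lt_def ffdot_ge0 andbT; apply: contra_neq u0 => u0.
by apply: ffnorm_eq0; rewrite /ffnorm [ffdot _ _]u0 sqrtr0.
Qed.

HB.instance Definition _ :=
  isDotProduct.Build R euclid euclid_dot euclid_dot_gt0.

End FiniteEuclidean.

(** * Singular value decomposition *)

Section OrthogonalMaximum.
Local Open Scope classical_set_scope.
Variable R : realType.

Lemma cont_sum (T : topologicalType) (J : finType) (f : J -> T -> R) :
  (forall j, continuous (f j)) -> continuous (fun v => \sum_j f j v).
Proof.
move=> cf v; apply: cvg_big => [|j _]; last exact: cf.
exact: add_continuous.
Qed.

Section EntrywiseContinuity.
Variable T : topologicalType.

Definition mx_continuous m n (g : T -> 'M[R]_(m, n)) :=
  forall i j, continuous (fun v => g v i j).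

Lemma mx_continuous_cst m n (A : 'M[R]_(m, n)) : mx_continuous (fun=> A).
Proof. by move=> i j; exact: cst_continuous. Qed.

Lemma mx_continuous_tr m n (g : T -> 'M[R]_(m, n)) :
  mx_continuous g -> mx_continuous (fun v => (g v)^T).
Proof.
move=> cg i j; rewrite [X in continuous X](_ : _ = fun v => g v j i)//.
by apply/funext => v; rewrite mxE.
Qed.

Lemma mx_continuous_mul m n p (g : T -> 'M[R]_(m, n)) (h : T -> 'M[R]_(n, p)) :
  mx_continuous g -> mx_continuous h -> mx_continuous (fun v => g v *m h v).
Proof.
move=> cg ch i j.
rewrite [X in continuous X](_ : _ = fun v => \sum_k g v i k * h v k j); last first.
  by apply/funext => v; rewrite mxE.
by apply: cont_sum => k v; apply: continuousM; [exact: cg|exact: ch].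
Qed.

Lemma continuous_mxtrace n (g : T -> 'M[R]_n) :
  mx_continuous g -> continuous (fun v => \tr (g v)).
Proof. by move=> cg; apply: cont_sum => i; exact: cg. Qed.

End EntrywiseContinuity.

(** The square of the entry is one of the nonnegative terms of (A A^T)_ii = 1. *)
Lemma frame_entry_le1 m n (A : 'M[R]_(m, n)) i j :
  A *m A^T = 1%:M -> `|A i j| <= 1.
Proof.
move=> /matrixP/(_ i i); rewrite !mxE eqxx mulr1n (bigD1 j)//= => A1.
rewrite -(ler_pXn2r (n := 2)) ?nnegrE// expr1n real_normK ?num_real// -A1 mxE.
rewrite -expr2 lerDl sumr_ge0// => k _; rewrite mxE -expr2; exact: sqr_ge0.
Qed.

(** Pairs of orthogonal matrices, packed into one row vector, form a closed set with entries bounded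
    by 1, hence a compact set on which the trace is continuous. *)
Lemma orthogonal_trace_max m n (A : 'M[R]_(n, m)) (X : 'M[R]_(m, n)) :
  exists (P : 'M[R]_m) (V : 'M[R]_n),
    [/\ P *m P^T = 1%:M, V *m V^T = 1%:M &
    forall (P' : 'M[R]_m) (V' : 'M[R]_n),
      P' *m P'^T = 1%:M -> V' *m V'^T = 1%:M ->
      \tr (A *m P' *m X *m V'^T) <= \tr (A *m P *m X *m V^T)].
Proof.
pose E := 'rV[R]_(m * m + n * n).
pose P (v : E) : 'M[R]_m := vec_mx (lsubmx v).
pose V (v : E) : 'M[R]_n := vec_mx (rsubmx v).
have PVK P' V' : P (row_mx (mxvec P') (mxvec V')) = P' /\
    V (row_mx (mxvec P') (mxvec V')) = V'.
  by rewrite /P /V row_mxKl row_mxKr !mxvecK.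
have cP : mx_continuous P.
  move=> i j; rewrite [X in continuous X](_ : _ =
    fun v : E => v 0 (lshift _ (mxvec_index i j))); first exact: coord_continuous.
  by apply/funext => v; rewrite !mxE.
have cV : mx_continuous V.
  move=> i j; rewrite [X in continuous X](_ : _ =
    fun v : E => v 0 (rshift _ (mxvec_index i j))); first exact: coord_continuous.
  by apply/funext => v; rewrite !mxE.
have closed_frame p q (g : E -> 'M[R]_(p, q)) : mx_continuous g ->
    closed [set v | g v *m (g v)^T = 1%:M].
  move=> cg; rewrite [X in closed X](_ : _ = \bigcap_(i in [set: 'I_p])
      \bigcap_(j in [set: 'I_p]) [set v | (g v *m (g v)^T) i j = (1%:M : 'M[R]_p) i j]).
    apply: closed_bigI => i _; apply: closed_bigI => j _.
    apply: (@preimage_closed _ _ (fun v => (g v *m (g v)^T) i j)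
      [set (1%:M : 'M[R]_p) i j]); last exact: closed_eq.
    by move=> v _; apply: mx_continuous_mul => //; exact: mx_continuous_tr.
  apply/seteqP; split => v /= => [gv i _ j _ /=|gv]; first by rewrite gv.
  by apply/matrixP => i j; exact: gv.
pose K := [set v | P v *m (P v)^T = 1%:M] `&` [set v | V v *m (V v)^T = 1%:M].
have K0 : K !=set0.
  exists (row_mx (mxvec 1%:M) (mxvec 1%:M)); rewrite /K /=.
  by have [-> ->] := PVK 1%:M 1%:M; rewrite !trmx1 !mulmx1.
have Kc : compact K.
  apply: bounded_closed_compact; last by apply: closedI; exact: closed_frame.
  exists 1; split; first exact: num_real.
  move=> M M1 v [/= Pv Vv]; rewrite [leLHS]/Num.norm/= mx_normrE.
  apply: bigmax_le => [|[i j] _ /=]; first by rewrite (le_trans _ (ltW M1)).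
  apply: le_trans (ltW M1); rewrite [i]ord1 -[j]splitK.
  case: (fintype.split j) => k /=; case/mxvec_indexP: k => a b.
  - by have := frame_entry_le1 a b Pv; rewrite !mxE.
  - by have := frame_entry_le1 a b Vv; rewrite !mxE.
have [|c /set_mem[/= Pc Vc] cmax] :=
    @compact_EVT_max _ R (fun v => \tr (A *m P v *m X *m (V v)^T)) K K0 Kc.
  apply: continuous_subspaceT; apply: continuous_mxtrace.
  apply: mx_continuous_mul; last exact: mx_continuous_tr.
  apply: mx_continuous_mul; last exact: mx_continuous_cst.
  by apply: mx_continuous_mul => //; exact: mx_continuous_cst.
exists (P c), (V c); split=> // P' V' P'1 V'1.
have [EP EV] := PVK P' V'.
have := cmax (row_mx (mxvec P') (mxvec V')); rewrite EP EV; apply.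
by apply/mem_set; rewrite /K /= EP EV.
Qed.

End OrthogonalMaximum.

Section TraceSymmetric.
Variable R : realFieldType.

(** The Householder reflection that negates u and fixes its orthogonal complement. *)
Definition reflection n (u : 'rV[R]_n) : 'M[R]_n :=
  1%:M - (2 / (u *m u^T) 0 0) *: (u^T *m u).

Lemma dotmx_gt0 n (u : 'rV[R]_n) : u != 0 -> 0 < (u *m u^T) 0 0.
Proof.
move=> u0; rewrite mxE lt_def sumr_ge0 ?andbT; last first.
  by move=> i _; rewrite mxE -expr2 sqr_ge0.
apply: contra_neq u0 => /eqP; rewrite psumr_eq0 => [/allP u0|i _]; last first.
  by rewrite mxE -expr2 sqr_ge0.
apply/rowP => i; have := u0 i (mem_index_enum i).
by rewrite !mxE mulf_eq0 orbb => /eqP.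
Qed.

Lemma reflection_tr n (u : 'rV[R]_n) : (reflection u)^T = reflection u.
Proof. by rewrite linearB/= linearZ/= trmx1 trmx_mul trmxK. Qed.

Lemma reflectionK n (u : 'rV[R]_n) :
  u != 0 -> reflection u *m reflection u = 1%:M.
Proof.
move=> /dotmx_gt0; set c := (_ *m _) 0 0 => c0.
have uu : u *m u^T = c%:M by rewrite [LHS]mx11_scalar.
rewrite /reflection -/c mulmxBr mulmx1 mulmxBl mul1mx -scalemxAl -scalemxAr.
rewrite mulmxA -(mulmxA _ u) uu mul_mx_scalar -scalemxAl !scalerA.
have -> : 2 / c * (2 / c * c) = 2 / c + 2 / c.
  by field; rewrite gt_eqF.
by rewrite scalerDl opprB addrK subrK.
Qed.

Lemma trace_reflections n (N : 'M[R]_n) (u v : 'rV[R]_n) :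
  \tr (N *m (reflection u *m reflection v)) =
  \tr N - 2 / (u *m u^T) 0 0 * (u *m N *m u^T) 0 0
        - 2 / (v *m v^T) 0 0 * (v *m N *m v^T) 0 0
        + 4 / ((u *m u^T) 0 0 * (v *m v^T) 0 0) *
            ((u *m v^T) 0 0 * (v *m N *m u^T) 0 0).
Proof.
have q (x y : 'rV[R]_n) : \tr (N *m (x^T *m y)) = (y *m N *m x^T) 0 0.
  by rewrite mulmxA mxtrace_mulC mulmxA trace_mx11.
rewrite /reflection; set a := 2 / _; set b := 2 / _.
rewrite mulmxBr mulmx1 mulmxBl mul1mx -scalemxAl -scalemxAr.
rewrite !mulmxBr mulmx1 -!scalemxAr !raddfB/=. rewrite !mxtraceZ !q.
have uv : u *m v^T = ((u *m v^T) 0 0)%:M by exact: mx11_scalar.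
set k := (u *m v^T) 0 0 in uv *.
rewrite -(mulmxA u^T) (mulmxA u) uv mul_scalar_mx -!scalemxAr mxtraceZ q.
have -> : 4 / ((u *m u^T) 0 0 * (v *m v^T) 0 0) = a * b.
  by rewrite /a /b invfM; ring.
by ring.
Qed.

Lemma trace_max_symmetric n (N : 'M[R]_n) :
  (forall G : 'M[R]_n, G *m G^T = 1%:M -> \tr (N *m G) <= \tr N) -> N^T = N.
Proof.
move=> Nmax; apply/matrixP => i j; rewrite mxE.
have [->//|ij] := eqVneq i j.
(* Two reflections in nearby lines compose to a small rotation; the first-order
   term of the trace in the angle is the skew part of N. *)
have q (x : R) : x * (N j i - N i j) <= x ^+ 2 * (N i i + N j j).
  have ee (k l : 'I_n) : ('e_k *m N *m ('e_l)^T : 'M[R]_1) 0 0 = N k l.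
    by rewrite -rowE trmx_delta -colE !mxE.
  have ed (k l : 'I_n) : ('e_k *m ('e_l)^T : 'M[R]_1) 0 0 = (k == l)%:R.
    by rewrite trmx_delta -colE !mxE eq_sym.
  have addE (A B : 'M[R]_1) : (A + B) 0 0 = A 0 0 + B 0 0 by rewrite mxE.
  have scaleE y (A : 'M[R]_1) : (y *: A) 0 0 = y * A 0 0 by rewrite mxE.
  pose u : 'rV[R]_n := 'e_i; pose v : 'rV[R]_n := 'e_i + x *: 'e_j.
  have uu : (u *m u^T) 0 0 = 1 by rewrite ed eqxx.
  have uv : (u *m v^T) 0 0 = 1.
    rewrite linearD/= linearZ/= mulmxDr -scalemxAr addE scaleE !ed eqxx.
    by rewrite (negbTE ij) mulr0 addr0.
  have vv : (v *m v^T) 0 0 = 1 + x ^+ 2.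
    rewrite linearD/= linearZ/= mulmxDr !mulmxDl -!scalemxAr -!scalemxAl.
    rewrite !(addE, scaleE, ed) !eqxx (negbTE ij) eq_sym (negbTE ij) /= ?mulr1n ?mulr0n.
    by ring.
  have uNu : (u *m N *m u^T) 0 0 = N i i by rewrite ee.
  have vNu : (v *m N *m u^T) 0 0 = N i i + x * N j i.
    by rewrite !mulmxDl -!scalemxAl addE scaleE !ee.
  have vNv : (v *m N *m v^T) 0 0 = N i i + x * (N i j + N j i) + x ^+ 2 * N j j.
    rewrite linearD/= linearZ/= mulmxDr !mulmxDl -!scalemxAr -!scalemxAl.
    by rewrite !(addE, scaleE, ee); ring.
  have u0 : u != 0.
    by apply/eqP => u0; have /eqP := uu; rewrite u0 mul0mx mxE eq_sym oner_eq0.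
  have v0 : v != 0.
    by apply/eqP => v0; have /eqP := uv; rewrite v0 trmx0 mulmx0 mxE eq_sym oner_eq0.
  have := Nmax (reflection u *m reflection v).
  rewrite trace_reflections uu uv vv uNu vNu vNv.
  rewrite trmx_mul !reflection_tr mulmxA -(mulmxA _ _ (reflection v)).
  rewrite reflectionK// mulmx1 reflectionK// => /(_ erefl).
  have x1 : 0 < 1 + x ^+ 2 by rewrite ltr_pwDl ?sqr_ge0.
  rewrite -subr_ge0 => /(mulr_ge0 (ltW x1)) H.
  rewrite -subr_ge0 -(pmulr_rge0 _ (ltr0n _ 2)).
  apply: (le_trans H); rewrite le_eqVlt; apply/orP; left; apply/eqP.
  by field; rewrite gt_eqF.
set b := N j i - N i j in q *; set a := N i i + N j j in q.
have b0 : b = 0.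
  have [//|b0] := eqVneq b 0.
  have := q 0 ; have a0 : 0 <= a by have := q 1; have := q (-1); lra.
  (* A linear function dominated by a quadratic one near 0 vanishes. At this x the gap is -b^2 / (a
     + 1)^2; using a + 1 avoids dividing by a = 0. *)
  have := q (b / (a + 1)); have a1 : 0 < a + 1 by lra.
  rewrite -subr_ge0 => H _.
  have : 0 <= - (b ^+ 2).
    rewrite -(pmulr_rge0 _ (_ : 0 < (a + 1) ^- 2)) ?invr_gt0 ?exprn_gt0//.
    suff -> : (a + 1) ^- 2 * - b ^+ 2 =
      (b / (a + 1)) ^+ 2 * a - b / (a + 1) * b by [].
    by field; rewrite gt_eqF.
  by rewrite oppr_ge0 => b2; have := sqr_ge0 b; have := expf_neq0 2 b0; lra.
by apply/eqP; rewrite -subr_eq0 -/b b0.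
Qed.

End TraceSymmetric.

Section SignFlip.
Variables (R : comNzRingType) (n : nat).

(** Flips commute with diagonal matrices and have determinant -1, so they move orthogonal factors
    into SO without disturbing the singular values. *)
Definition flip_row (k : 'I_n) : 'rV[R]_n := \row_j (-1) ^+ (j == k).
Definition flip_mx (k : 'I_n) : 'M[R]_n := diag_mx (flip_row k).

Lemma flip_mx_tr k : (flip_mx k)^T = flip_mx k.
Proof. exact: tr_diag_mx. Qed.

Lemma flip_mxK k : flip_mx k *m flip_mx k = 1%:M.
Proof.
rewrite /flip_mx mulmx_diag -diag_const_mx; congr diag_mx.
by apply/rowP => j; rewrite !mxE -expr2 sqrr_sign.
Qed.

Lemma det_flip_mx k : \det (flip_mx k) = -1.
Proof.
rewrite det_diag (bigD1 k)//= mxE eqxx big1 ?mulr1// => j /negPf jk.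
by rewrite mxE jk.
Qed.

End SignFlip.

Section SingularValueDecomposition.
Variable R : realType.

Lemma full_svd r m (X : 'M[R]_(r, r + m)) :
  exists (P : 'M[R]_r) (s : 'rV[R]_r) (V : 'M[R]_(r + m)),
  [/\ P *m P^T = 1%:M, V *m V^T = 1%:M, forall i, 0 <= s 0 i,
      forall i j : 'I_r, (i <= j)%N -> s 0 j <= s 0 i &
      P *m X *m V^T = row_mx (diag_mx s) 0].
Proof.
(* Distinct positive weights w force a maximizer of the trace to diagonalize X:
   first-order optimality in V and in P makes both W M and M W symmetric. *)
pose w : 'rV[R]_r := \row_i (r - i)%:R.
have w_gt0 i : 0 < w 0 i by rewrite mxE ltr0n subn_gt0.
pose W := diag_mx w.
pose A : 'M[R]_(r + m, r) := col_mx W 0.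
have [P [V [P1 V1 PVmax]]] := orthogonal_trace_max A X.
have [M PXV] : exists M, P *m X *m V^T = M by exists (P *m X *m V^T).
have ME : A *m P *m X *m V^T = A *m M by rewrite -PXV !mulmxA.
have maxM (G : 'M[R]_r) (H : 'M[R]_(r + m)) :
    G *m G^T = 1%:M -> H *m H^T = 1%:M -> \tr (A *m G *m M *m H^T) <= \tr (A *m M).
  move=> G1 H1; rewrite -ME -PXV !mulmxA.
  have := PVmax (G *m P) (H *m V); rewrite !trmx_mul !mulmxA.
  rewrite -(mulmxA G) P1 mulmx1 G1 -(mulmxA H) V1 mulmx1 H1.
  by apply.
have [M1 [M2 EM]] : exists M1 M2, M = row_mx M1 M2.
  by exists (lsubmx M), (rsubmx M); rewrite hsubmxK.
have AM : A *m M = block_mx (W *m M1) (W *m M2) 0 0.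
  by rewrite EM mul_col_row !mul0mx.
have MA : M *m A = M1 *m W by rewrite EM mul_row_col mulmx0 addr0.
have /trace_max_symmetric : forall G : 'M[R]_(r + m),
    G *m G^T = 1%:M -> \tr (A *m M *m G) <= \tr (A *m M).
  move=> G /mulmx1C G1; have := maxM 1%:M G^T.
  by rewrite trmx1 !mulmx1 trmxK => /(_ erefl G1).
rewrite AM tr_block_mx => /eq_block_mx[symWM WM2 _ _].
have maxP (G : 'M[R]_r) : G *m G^T = 1%:M -> \tr (M1 *m W *m G) <= \tr (M1 *m W).
  move=> G1; have := maxM G 1%:M; rewrite trmx1 !mulmx1 => /(_ G1 erefl).
  rewrite [\tr (A *m M)]mxtrace_mulC MA.
  suff -> : \tr (A *m G *m M) = \tr (M1 *m W *m G) by [].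
  by rewrite -mulmxA mxtrace_mulC -MA [RHS]mxtrace_mulC mulmxA.
have symMW := trace_max_symmetric maxP.
(* The two symmetries combine to (w_i^2 - w_j^2) M_ij = 0, and the weights are distinct and
   positive. *)
have M1_diag i j : i != j -> M1 i j = 0.
  move=> ij.
  have E1 : w 0 i * M1 i j = w 0 j * M1 j i.
    by have /matrixP/(_ j i) := symWM; rewrite mul_diag_mx !mxE.
  have E2 : M1 i j * w 0 j = M1 j i * w 0 i.
    by have /matrixP/(_ j i) := symMW; rewrite mul_mx_diag !mxE.
  have : (w 0 i ^+ 2 - w 0 j ^+ 2) * M1 i j = 0.
    rewrite mulrBl expr2 -mulrA E1 expr2 -[w 0 j * _ * _]mulrA [w 0 j * M1 i j]mulrC E2.
    by ring.
  move/eqP; rewrite mulf_eq0 => /orP[|/eqP//].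
  rewrite subr_eq0 eqrXn2 ?ltW// !mxE eqr_nat => /eqP ij'.
  have := ltn_ord i; have := ltn_ord j; move/eqP: ij => ij ? ?.
  by case: ij; apply: val_inj => /=; lia.
have M20 : M2 = 0.
  apply/matrixP => i j; have /matrixP/(_ i j) := WM2.
  rewrite trmx0 mul_diag_mx !mxE => /esym/eqP; rewrite mulf_eq0 => /orP[|/eqP//].
  by have := w_gt0 i; rewrite mxE => /gt_eqF ->.
pose s : 'rV[R]_r := \row_i M1 i i.
have EM1 : M1 = diag_mx s.
  apply/matrixP => i j; rewrite !mxE.
  by have [->|/M1_diag ->] := eqVneq i j; rewrite ?mulr1n ?mulr0n.
have tr_sw (d : 'rV[R]_r) : \tr (diag_mx d *m M1) = \sum_i d 0 i * s 0 i.
  rewrite EM1 mulmx_diag mxtrace_diag; apply: eq_bigr => i _.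
  by rewrite !mxE.
(* Flipping the k-th sign lowers the trace by 2 w_k s_k, so maximality makes this nonnegative. *)
have s_ge0 k : 0 <= s 0 k.
  have := maxP (flip_mx R k); rewrite flip_mx_tr flip_mxK => /(_ erefl).
  rewrite -mulmxA mulmx_diag mxtrace_mulC tr_sw.
  rewrite mxtrace_mulC tr_sw -subr_ge0 -sumrB (bigD1 k)//= big1 => [|i /negPf ik].
    rewrite !mxE eqxx expr1 addr0 mulrN1 mulNr opprK -mulr2n pmulrn_lge0//.
    by have := w_gt0 k; rewrite mxE => /pmulr_rge0 ->.
  by rewrite !mxE ik expr0 mulr1 subrr.
(* Exchanging i and j on both sides swaps two weights; maximality gives (w_i - w_j)(s_i - s_j) >= 0,
   and the weights decrease. *)
have s_sorted (i j : 'I_r) : (i <= j)%N -> s 0 j <= s 0 i.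
  rewrite leq_eqVlt => /orP[/eqP/val_inj->//|ij].
  pose T : 'M[R]_r := perm_mx (tperm i j).
  have TT : T *m T^T = 1%:M by rewrite tr_perm_mx -perm_mxM mulgV perm_mx1.
  have := maxM T (block_mx T 0 0 1%:M) TT.
  rewrite tr_block_mx mulmx_block !trmx0 !mul0mx !mulmx0 !addr0 add0r TT.
  rewrite trmx1 mulmx1 -scalar_mx_block => /(_ erefl).
  rewrite EM EM1 M20 /A mul_col_mx mul0mx mul_col_row !mul0mx mulmx0.
  rewrite mulmx_block mul_col_row !mul0mx !mulmx0 !addr0 !mxtrace_block !mxtrace0 !addr0.
  rewrite -EM1 tr_sw.
  have -> : \tr (W *m T *m M1 *m T^T) = \sum_k w 0 (tperm i j k) * s 0 k.
    rewrite mxtrace_mulC !mulmxA.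
    have -> : T^T *m W *m T = diag_mx (\row_k w 0 (tperm i j k)).
      rewrite /T tr_perm_mx tpermV -row_permE.
      rewrite -{2}(tpermV i j) -col_permE; apply/matrixP => a b.
      by rewrite !mxE (inj_eq perm_inj).
    by rewrite tr_sw; apply: eq_bigr => k _; rewrite mxE.
  have ij' : j != i by apply: contraTneq ij => ->; rewrite ltnn.
  rewrite -subr_ge0 -sumrB (bigD1 i)//= (bigD1 j)//= big1 => [|k /andP[ki kj]].
    rewrite tpermL tpermR addr0 => H.
    have : 0 <= (w 0 i - w 0 j) * (s 0 i - s 0 j) by move: H; lra.
    rewrite pmulr_rge0 ?subr_ge0// subr_gt0 !mxE ltr_nat.
    by have := ltn_ord j; have := ltn_ord i; lia.
  by rewrite tpermD 1?eq_sym// subrr.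
exists P, s, V; split=> //.
by rewrite PXV EM EM1 M20.
Qed.

Lemma det_orthogonal r (O : 'M[R]_r) :
  O *m O^T = 1%:M -> \det O = 1 \/ \det O = -1.
Proof.
move=> /(congr1 determinant)/eqP; rewrite det_mulmx det_tr det1 -expr2.
by rewrite sqrf_eq1 => /orP[/eqP|/eqP]; [left|right].
Qed.

(** The first r rows of the full right factor suffice. If the left factor has determinant -1, a flip
    D is inserted on both sides of the diagonal, which is harmless since D commutes with it and D^2
    = 1. *)
Lemma thin_svd_exists r n (X : 'M[R]_(r, n)) : (r <= n)%N ->
  exists U s V, thin_svd X U s V.
Proof.
move=> /subnKC rn; move: (n - r)%N rn => m rn; subst n.
have [P [s [V [P1 V1 s0 sd E]]]] := full_svd X.
have PP := mulmx1C P1.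
have Vu1 : usubmx V *m (usubmx V)^T = 1%:M.
  move: V1; rewrite -{1 2}(vsubmxK V) tr_col_mx mul_col_row scalar_mx_block.
  by move=> /eq_block_mx[].
have XE : X = P^T *m diag_mx s *m usubmx V.
  transitivity (P^T *m (P *m X *m V^T) *m V).
    by rewrite !mulmxA PP mul1mx -mulmxA (mulmx1C V1) mulmx1.
  by rewrite E -{1}(vsubmxK V) -!mulmxA mul_row_col mul0mx addr0.
have [detP|detP] := det_orthogonal P1.
  exists P^T, s, (usubmx V); split=> //.
  by split; rewrite ?trmxK // det_tr.
(* An empty determinant is 1, so r is positive here and there is an index to flip. *)
case: r => [|r] in X P s V P1 V1 s0 sd E PP Vu1 XE detP *.
  by move: detP; rewrite det_mx00 => /eqP; rewrite eq_sym eqNr oner_eq0.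
pose D := flip_mx R (@ord0 r).
exists (P^T *m D), s, (D *m usubmx V); split=> //.
- split; last by rewrite det_mulmx det_tr detP det_flip_mx mulrNN mulr1.
  by rewrite trmx_mul flip_mx_tr mulmxA -(mulmxA P^T) flip_mxK mulmx1 trmxK.
- by rewrite trmx_mul flip_mx_tr mulmxA -(mulmxA D) Vu1 mulmx1 flip_mxK.
- have -> : P^T *m D *m diag_mx s = P^T *m diag_mx s *m D.
    by rewrite -!mulmxA diag_mxC.
  by rewrite mulmxA -(mulmxA _ D D) flip_mxK mulmx1.
Qed.

End SingularValueDecomposition.

(** * The Cauchy-Binet formula *)

Section CauchyBinet.
Variables (R : comNzRingType) (r n : nat).

Lemma cols_of_inj (S : colset r n) : injective (cols_of S).
Proof. by move=> i j /enum_val_inj/cast_ord_inj. Qed.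

Lemma cols_of_mem (S : colset r n) i : cols_of S i \in val S.
Proof. exact: enum_valP. Qed.

Lemma cols_of_onto (S : colset r n) k : k \in val S -> exists i, cols_of S i = k.
Proof.
move=> kS; exists (cast_ord (eqP (valP S)) (enum_rank_in kS k)).
by rewrite /cols_of cast_ordK enum_rankK_in.
Qed.

(** Multilinearity in the rows: f picks, for each row of the product, the row of B that
    contributes. *)
Lemma det_mulmx_sum (A : 'M[R]_(r, n)) (B : 'M[R]_(n, r)) :
  \det (A *m B) =
  \sum_(f : {ffun 'I_r -> 'I_n}) (\prod_i A i (f i)) * \det (rowsub f B).
Proof.
transitivity (\sum_(s : 'S_r) \sum_(f : {ffun 'I_r -> 'I_n})
    (-1) ^+ s * \prod_i (A i (f i) * B (f i) (s i))).
  apply: eq_bigr => s _; rewrite -mulr_sumr; congr (_ * _).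
  transitivity (\prod_i \sum_k A i k * B k (s i)); last exact: bigA_distr_bigA.
  by apply: eq_bigr => i _; exact: mxE.
rewrite exchange_big; apply: eq_bigr => f _; rewrite /determinant mulr_sumr.
apply: eq_bigr => s _; rewrite big_split/= mulrCA; congr (_ * (_ * _)).
by apply: eq_bigr => i _; rewrite mxE.
Qed.

(** In the multilinear expansion a non-injective f repeats a row and contributes 0. An injective f
    is uniquely a permutation followed by the increasing enumeration of its image S, and for fixed S
    the permutations rebuild the minor of A. *)
Lemma cauchy_binet (A : 'M[R]_(r, n)) (B : 'M[R]_(n, r)) :
  \det (A *m B) = \sum_(S : colset r n)
    \det (colsub (cols_of S) A) * \det (rowsub (cols_of S) B).
Proof.
pose G (f : {ffun 'I_r -> 'I_n}) := (\prod_i A i (f i)) * \det (rowsub f B).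
pose h (x : colset r n * 'S_r) : {ffun 'I_r -> 'I_n} :=
  [ffun i => cols_of x.1 (x.2 i)].
have h_inj : injective h.
  move=> [S s] [S' s'] /ffunP hh.
  have {}hh i : cols_of S (s i) = cols_of S' (s' i) by have := hh i; rewrite !ffunE.
  have SS' : S = S'.
    apply: val_inj; apply/setP => k; apply/idP/idP => /cols_of_onto[i <-].
    - by rewrite -(permKV s i) hh cols_of_mem.
    - by rewrite -(permKV s' i) -hh cols_of_mem.
  rewrite -{}SS' in hh *; congr (_, _); apply/perm.permP => i.
  exact: cols_of_inj (hh i).
transitivity (\sum_(f in h @: [set: colset r n * 'S_r]%SET) G f).
  rewrite det_mulmx_sum [RHS]big_mkcond; apply: eq_bigr => f _ /=.
  case: ifPn => // /imsetP nf; rewrite -/(G f).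
  have [/injectiveP f_inj|/injectivePn[i [j ij fij]]] := boolP (injectiveb f).
    have cardS : #|f @: [set: 'I_r]%SET| == r by rewrite card_imset// cardsT card_ord.
    pose S : colset r n := exist _ (f @: [set: 'I_r]%SET) cardS.
    have fS i : exists j, cols_of S j == f i.
      have [j jE] := @cols_of_onto S (f i) (imset_f _ (finset.in_setT i)).
      by exists j; apply/eqP.
    pose g i := xchoose (fS i).
    have gE i : cols_of S (g i) = f i by apply/eqP; exact: xchooseP (fS i).
    have g_inj : injective g by move=> i j gij; apply: f_inj; rewrite -!gE gij.
    case: nf; exists (S, perm g_inj); first exact: finset.in_setT.
    by apply/ffunP => i; rewrite ffunE permE gE.
  rewrite /G (determinant_alternate ij) ?mulr0// => k.
  by rewrite !mxE fij.
rewrite big_imset/=; last by move=> x y _ _; exact: h_inj.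
transitivity (\sum_x G (h x)); first by apply: eq_bigl => x; rewrite finset.in_setT.
rewrite -(pair_bigA _ (fun S s => G (h (S, s))))/=.
apply: eq_bigr => S _; rewrite /determinant mulr_suml; apply: eq_bigr => s _.
rewrite /G; have -> : rowsub (h (S, s)) B = row_perm s (rowsub (cols_of S) B).
  by apply/matrixP => i j; rewrite !mxE ffunE.
rewrite row_permE det_mulmx det_perm -/(\det _) mulrA; congr (_ * _).
rewrite mulrC; congr (_ * _); apply: eq_bigr => i _.
by rewrite !mxE ffunE.
Qed.

End CauchyBinet.

(** * Overlaps of frames *)

Section FrobeniusInnerProduct.
Variable R : realType.

Lemma frob_sqr p q (A : 'M[R]_(p, q)) : frob A ^+ 2 = \sum_i \sum_j A i j ^+ 2.
Proof.
rewrite sqr_sqrtr// sumr_ge0// => i _; rewrite sumr_ge0// => j _.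
exact: sqr_ge0.
Qed.

Lemma frob_ge0 p q (A : 'M[R]_(p, q)) : 0 <= frob A.
Proof. exact: sqrtr_ge0. Qed.

Lemma mxtrace_mul_tr p q (A B : 'M[R]_(p, q)) :
  \tr (A *m B^T) = \sum_i \sum_j A i j * B i j.
Proof.
by apply: eq_bigr => i _; rewrite mxE; apply: eq_bigr => j _; rewrite mxE.
Qed.

Lemma frob_sqr_trace p q (A : 'M[R]_(p, q)) : frob A ^+ 2 = \tr (A *m A^T).
Proof.
rewrite frob_sqr mxtrace_mul_tr; apply: eq_bigr => i _.
by apply: eq_bigr => j _; rewrite expr2.
Qed.

Lemma frob_sqrB p q (A B : 'M[R]_(p, q)) :
  frob (A - B) ^+ 2 = frob A ^+ 2 + frob B ^+ 2 - 2 * \tr (A *m B^T).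
Proof.
rewrite !frob_sqr mxtrace_mul_tr mulr_sumr -big_split -sumrB.
apply: eq_bigr => i _; rewrite mulr_sumr -big_split -sumrB.
by apply: eq_bigr => j _; rewrite !mxE /=; ring.
Qed.

Lemma frob_sqrD_le p q (A B : 'M[R]_(p, q)) :
  frob (A + B) ^+ 2 <= 2 * frob A ^+ 2 + 2 * frob B ^+ 2.
Proof.
rewrite !frob_sqr !mulr_sumr -big_split; apply: ler_sum => i _.
rewrite !mulr_sumr -big_split; apply: ler_sum => j _ /=.
rewrite mxE -subr_ge0; have := sqr_ge0 (A i j - B i j).
by congr (0 <= _); ring.
Qed.

Lemma frobC p q (A B : 'M[R]_(p, q)) : frob (A - B) = frob (B - A).
Proof.
congr Num.sqrt; apply: eq_bigr => i _; apply: eq_bigr => j _.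
by rewrite !mxE; ring.
Qed.

(** The left factors are m x r so that one formula serves both X (with m = r) and [phi X] (with m =
    n and left factor V^T). *)
Lemma mxtrace_svd m r n (U U' : 'M[R]_(m, r)) (s t : 'rV[R]_r)
    (V V' : 'M[R]_(r, n)) :
  \tr (U *m diag_mx s *m V *m (U' *m diag_mx t *m V')^T) =
  \sum_i \sum_j s 0 i * t 0 j * ((U^T *m U') i j * (V *m V'^T) i j).
Proof.
transitivity (\tr (diag_mx s *m (V *m V'^T) *m diag_mx t *m (U^T *m U')^T)).
  by rewrite !trmx_mul trmxK tr_diag_mx -!mulmxA mxtrace_mulC !mulmxA.
rewrite mxtrace_mul_tr; apply: eq_bigr => i _; apply: eq_bigr => j _.
by rewrite mul_mx_diag mul_diag_mx [X in X * _]mxE [X in X * _ * _]mxE; ring.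
Qed.

Lemma frob_svd m r n (U : 'M[R]_(m, r)) (s : 'rV[R]_r) (V : 'M[R]_(r, n)) :
  U^T *m U = 1%:M -> V *m V^T = 1%:M ->
  frob (U *m diag_mx s *m V) ^+ 2 = \sum_i s 0 i ^+ 2.
Proof.
move=> U1 V1; rewrite frob_sqr_trace mxtrace_svd U1 V1; apply: eq_bigr => i _.
rewrite (bigD1 i)//= big1 => [|j /negPf ji]; rewrite !mxE ?eqxx.
  by rewrite !mulr1 addr0 expr2.
by rewrite eq_sym ji !mulr0.
Qed.

Lemma frob_svdB m r n (U U' : 'M[R]_(m, r)) (s t : 'rV[R]_r)
    (V V' : 'M[R]_(r, n)) :
  U^T *m U = 1%:M -> U'^T *m U' = 1%:M -> V *m V^T = 1%:M -> V' *m V'^T = 1%:M ->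
  frob (U *m diag_mx s *m V - U' *m diag_mx t *m V') ^+ 2 =
  \sum_i s 0 i ^+ 2 + \sum_i t 0 i ^+ 2 -
  2 * \sum_i \sum_j s 0 i * t 0 j * ((U^T *m U') i j * (V *m V'^T) i j).
Proof. by move=> *; rewrite frob_sqrB !frob_svd// mxtrace_svd. Qed.

End FrobeniusInnerProduct.

Section FrameOverlap.
Variable R : realType.

Lemma mul_frame m r n (O : 'M[R]_(m, r)) (A : 'M[R]_(r, n)) :
  O *m O^T = 1%:M -> A *m A^T = 1%:M -> (O *m A) *m (O *m A)^T = 1%:M.
Proof. by move=> O1 A1; rewrite trmx_mul mulmxA -(mulmxA O) A1 mulmx1. Qed.

Lemma frame_overlap_row m r n (A : 'M[R]_(m, n)) (B : 'M[R]_(r, n)) i :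
  A *m A^T = 1%:M -> B *m B^T = 1%:M -> \sum_j (A *m B^T) i j ^+ 2 <= 1.
Proof.
(* The defect is the squared norm of the part of row i of A orthogonal to B. *)
move=> A1 B1; pose Z := A - A *m B^T *m B.
have ZZ : Z *m Z^T = 1%:M - A *m B^T *m (A *m B^T)^T.
  rewrite /Z linearB/= !trmx_mul trmxK mulmxBr !mulmxBl A1 -!mulmxA.
  rewrite [B *m (B^T *m _)]mulmxA B1 mul1mx.
  by rewrite [X in _ - X]subrr subr0.
rewrite -subr_ge0; have <- : (Z *m Z^T) i i = 1 - \sum_j (A *m B^T) i j ^+ 2.
  rewrite ZZ mxE [X in X + _]mxE [X in _ + X]mxE eqxx mulr1n; congr (_ - _).
  by rewrite [LHS]mxE; apply: eq_bigr => j _; rewrite [X in _ * X]mxE expr2.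
by rewrite mxE sumr_ge0// => k _; rewrite [X in _ * X]mxE -expr2 sqr_ge0.
Qed.

Lemma frame_overlap_col m r n (A : 'M[R]_(m, n)) (B : 'M[R]_(r, n)) j :
  A *m A^T = 1%:M -> B *m B^T = 1%:M -> \sum_i (A *m B^T) i j ^+ 2 <= 1.
Proof.
move=> A1 B1; apply: le_trans (frame_overlap_row j B1 A1).
have -> : A *m B^T = (B *m A^T)^T by rewrite trmx_mul trmxK.
by apply: ler_sum => i _; rewrite [X in X ^+ 2 <= _]mxE.
Qed.

Lemma frame_overlap_le1 m r n (A : 'M[R]_(m, n)) (B : 'M[R]_(r, n)) i j :
  A *m A^T = 1%:M -> B *m B^T = 1%:M -> (A *m B^T) i j <= 1.
Proof.
move=> A1 B1; rewrite (le_trans (ler_norm _))//.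
rewrite -(ler_pXn2r (n := 2)) ?nnegrE// expr1n real_normK ?num_real//.
apply: le_trans (frame_overlap_row i A1 B1).
by rewrite (bigD1 j)//= lerDl sumr_ge0// => k _; exact: sqr_ge0.
Qed.

Lemma trace_orthogonal_le r (O : 'M[R]_r) : O *m O^T = 1%:M -> \tr O <= r%:R.
Proof.
move=> O1; rewrite -[r in leRHS]card_ord -sumr_const; apply: ler_sum => i _.
by rewrite (le_trans (ler_norm _))// frame_entry_le1.
Qed.

Lemma trace_improper_le r (O : 'M[R]_r) :
  O *m O^T = 1%:M -> \det O = -1 -> \tr O + 2 <= r%:R.
Proof.
(* O has an eigenvector v of eigenvalue -1; compose with the reflection in v. *)
move=> O1 detO.
have det0 : \det (1%:M + O) = 0.
  (* Taking determinants shows that det (1 + O) is its own opposite. *)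
  have E : 1%:M + O = O *m (1%:M + O)^T.
    by rewrite linearD/= trmx1 mulmxDr mulmx1 O1 addrC.
  have : \det (1%:M + O) = - \det (1%:M + O).
    by rewrite {1}E det_mulmx det_tr detO mulN1r.
  by move=> ?; lra.
have /det0P[v v0 vO] := introT eqP det0.
have {}vO : v *m O = - v.
  by move: vO; rewrite mulmxDr mulmx1 => /eqP; rewrite addrC addr_eq0 => /eqP.
have <- : \tr (O *m reflection v) = \tr O + 2.
  rewrite /reflection mulmxBr mulmx1 -scalemxAr raddfB/= mxtraceZ.
  rewrite mulmxA mxtrace_mulC mulmxA vO mulNmx raddfN/= trace_mx11 mulrN opprK.
  by rewrite divfK// gt_eqF// dotmx_gt0.
apply: trace_orthogonal_le; apply: mul_frame => //.
by rewrite reflection_tr reflectionK.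
Qed.

Lemma prod_le_coord (I : finType) (d : I -> R) k :
  (forall i, 0 <= d i <= 1) -> \prod_i d i <= d k.
Proof.
move=> d01; rewrite (bigD1 k)//= ler_piMr//; first by have /andP[] := d01 k.
by apply: prodr_ile1 => i _; exact: d01.
Qed.

(** Weierstrass product inequality, by induction from 1 - dp <= (1 - d) + (1 - p), which is (1 -
    d)(1 - p) >= 0. *)
Lemma sum_complement_ge_prod (I : finType) (d : I -> R) :
  (forall i, 0 <= d i <= 1) -> 1 - \prod_i d i <= \sum_i (1 - d i).
Proof.
move=> d01; elim: index_enum => [|i l IH]; first by rewrite !big_nil subrr.
rewrite !big_cons; have /andP[d0 d1] := d01 i.
have p1 : \prod_(j <- l) d j <= 1 by apply: prodr_ile1 => j _; exact: d01.
by move: IH p1; set p := \prod_(_ <- _) _; set q := \sum_(_ <- _) _; nra.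
Qed.

(** Write the overlap as U diag(d) V and put O = V U. Its trace is the sum of d_i O_ii and its
    determinant is det O times the product of the d_i, all of which lie in [0, 1]. For det O = 1 the
    product inequality suffices. *)
Lemma frame_overlap_trace r n (A B : 'M[R]_(r, n)) :
  A *m A^T = 1%:M -> B *m B^T = 1%:M ->
  \tr (A *m B^T) <= r%:R - 1 + \det (A *m B^T).
Proof.
move=> A1 B1.
have [U [d [V [[U1 detU] d0 dsorted V1 WE]]]] := thin_svd_exists (A *m B^T) (leqnn r).
have d1 i : d 0 i <= 1.
  have -> : d 0 i = ((U^T *m A) *m (V *m B)^T) i i.
    rewrite trmx_mul mulmxA -(mulmxA _ A) WE !mulmxA (mulmx1C U1) mul1mx.
    by rewrite -mulmxA V1 mulmx1 mxE eqxx mulr1n.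
  apply: frame_overlap_le1; apply: mul_frame => //.
  by rewrite trmxK (mulmx1C U1).
have d01 i : 0 <= d 0 i <= 1 by rewrite d0 d1.
pose O := V *m U.
have O1 : O *m O^T = 1%:M by apply: mul_frame.
have Oii i : O i i <= 1 by rewrite (le_trans (ler_norm _))// frame_entry_le1.
have -> : \tr (A *m B^T) = \sum_i d 0 i * O i i.
  rewrite WE -mulmxA mxtrace_mulC -mulmxA mul_diag_mx.
  by apply: eq_bigr => i _; rewrite mxE.
have -> : \det (A *m B^T) = \prod_i d 0 i * \det O.
  by rewrite WE !det_mulmx det_diag detU mul1r mulr1.
have := sum_complement_ge_prod d01.
rewrite sumrB sumr_const card_ord => dprod.
have [->|detO] := det_orthogonal O1.
  rewrite mulr1; apply: (@le_trans _ _ (\sum_i d 0 i)); last by move: dprod; lra.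
  by apply: ler_sum => i _; rewrite ler_piMr.
case: r => [|r] in A B A1 B1 U d V U1 detU d0 dsorted V1 WE d1 d01 O O1 Oii dprod detO *.
  by have := detO; rewrite det_mx00; lra.
(* For det O = -1, tr O <= r - 2. Splitting the smallest value m off every d_i bounds the trace by
   the sum of the d_i minus 2m, hence by r - 1 + p - 2m with p the product of the d_i; finally p <=
   m. *)
pose m := d 0 ord_max.
have dm i : m <= d 0 i by apply: dsorted; rewrite -ltnS.
have dO : \sum_i d 0 i * O i i <= \sum_i (d 0 i - m) + m * \tr O.
  rewrite mulr_sumr -big_split; apply: ler_sum => i _ /=.
  by have := dm i; have := Oii i; nra.
move: dO; rewrite sumrB sumr_const card_ord -mulr_natr => dO.
have := trace_improper_le O1 detO.
have := prod_le_coord ord_max d01; rewrite -/m detO.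
have : 0 <= m := d0 ord_max.
move: dO dprod; set S := \sum_i d 0 i; set p := \prod_i _; set T := \tr O.
set D := \sum_i _; rewrite -/m; nra.
Qed.

End FrameOverlap.

Section OverlapInequalities.
Variables (R : realFieldType) (r : nat).
Implicit Types (s t : 'I_r -> R) (O W G : 'I_r -> 'I_r -> R).

(** The unit rows and columns of O spread s_i^2 and t_j^2 over pairs with weight O_ij^2. The two
    sides then differ, pair by pair, by O_ij^2 (s_i - t_j)^2 + 2 s_i t_j (O_ij - W_ij)^2. *)
Lemma sqrt_overlap_le s t O W :
  (forall i, 0 <= s i) -> (forall j, 0 <= t j) ->
  (forall i, \sum_j O i j ^+ 2 = 1) -> (forall j, \sum_i O i j ^+ 2 = 1) ->
  \sum_i s i ^+ 2 + \sum_j t j ^+ 2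
    - 2 * \sum_i \sum_j s i * t j * (W i j * W i j) <=
  2 * (\sum_i s i ^+ 2 + \sum_j t j ^+ 2
    - 2 * \sum_i \sum_j s i * t j * (O i j * W i j)).
Proof.
move=> s0 t0 O_row O_col.
have -> : \sum_i s i ^+ 2 = \sum_i \sum_j O i j ^+ 2 * s i ^+ 2.
  by apply: eq_bigr => i _; rewrite -mulr_suml O_row mul1r.
have -> : \sum_j t j ^+ 2 = \sum_i \sum_j O i j ^+ 2 * t j ^+ 2.
  by rewrite exchange_big; apply: eq_bigr => j _; rewrite -mulr_suml O_col mul1r.
rewrite -big_split/= !mulr_sumr -!sumrB mulr_sumr; apply: ler_sum => i _.
rewrite -big_split/= !mulr_sumr -!sumrB mulr_sumr; apply: ler_sum => j _.
rewrite -subr_ge0.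
have : 0 <= O i j ^+ 2 * (s i - t j) ^+ 2 + 2 * (s i * t j) * (O i j - W i j) ^+ 2.
  by rewrite addr_ge0// mulr_ge0 ?sqr_ge0// !mulr_ge0.
by congr (0 <= _); ring.
Qed.

(* Clamping s and t at b = min t decreases the left-hand side; there the bound
   is a sum of pointwise AM-GM inequalities. *)
Lemma min_overlap_le_aux s t G (a b delta : R) i0 :
  0 <= a <= b -> (forall i, a <= s i) -> s i0 = a -> (forall j, b <= t j) ->
  (forall i, \sum_j `|G i j| <= 1) -> (forall j, \sum_i `|G i j| <= 1) ->
  \sum_i \sum_j G i j <= r%:R - 1 + delta ->
  a ^+ 2 + b ^+ 2 - 2 * (a * b) * delta <=
  \sum_i s i ^+ 2 + \sum_j t j ^+ 2 - 2 * \sum_i \sum_j s i * t j * G i j.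
Proof.
move=> /andP[a0 ab] sa si0 tb G_row G_col G_sum.
pose p i := Num.min (s i) b.
have b0 : 0 <= b := le_trans a0 ab.
(* The form becomes a sum of squares weighted by the slack of the row and column sums, plus pair
   terms |G_ij| (x_i - y_j)^2 or |G_ij| (x_i + y_j)^2 according to the sign of G_ij. Clamping
   increases none of these. *)
have expand (x y : 'I_r -> R) :
  \sum_i x i ^+ 2 + \sum_j y j ^+ 2 - 2 * \sum_i \sum_j x i * y j * G i j =
  \sum_i (1 - \sum_j `|G i j|) * x i ^+ 2 + \sum_j (1 - \sum_i `|G i j|) * y j ^+ 2
  + \sum_i \sum_j (`|G i j| * (x i ^+ 2 + y j ^+ 2) - 2 * (x i * y j * G i j)).
  have -> : \sum_i (1 - \sum_j `|G i j|) * x i ^+ 2 =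
      \sum_i x i ^+ 2 - \sum_i \sum_j `|G i j| * x i ^+ 2.
    by rewrite -sumrB; apply: eq_bigr => i _; rewrite mulrBl mul1r mulr_suml.
  have -> : \sum_j (1 - \sum_i `|G i j|) * y j ^+ 2 =
      \sum_j y j ^+ 2 - \sum_i \sum_j `|G i j| * y j ^+ 2.
    rewrite [X in _ = _ - X]exchange_big -sumrB; apply: eq_bigr => j _.
    by rewrite mulrBl mul1r mulr_suml.
  have -> : \sum_i \sum_j (`|G i j| * (x i ^+ 2 + y j ^+ 2) - 2 * (x i * y j * G i j)) =
      \sum_i \sum_j `|G i j| * x i ^+ 2 + \sum_i \sum_j `|G i j| * y j ^+ 2
      - 2 * \sum_i \sum_j x i * y j * G i j.
    rewrite mulr_sumr -big_split -sumrB; apply: eq_bigr => i _.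
    rewrite mulr_sumr -big_split -sumrB; apply: eq_bigr => j _ /=.
    by ring.
  by ring.
have p_ge i : a <= p i by rewrite le_min sa ab.
have p0 i : 0 <= p i := le_trans a0 (p_ge i).
have ps i : p i <= s i by rewrite ge_min lexx.
have pb i : p i <= b by rewrite ge_min lexx orbT.
have clamp : \sum_i p i ^+ 2 + \sum_(j < r) b ^+ 2
    - 2 * \sum_i \sum_j p i * b * G i j <=
  \sum_i s i ^+ 2 + \sum_j t j ^+ 2 - 2 * \sum_i \sum_j s i * t j * G i j.
  rewrite (expand p (fun=> b)) (expand s t); apply: lerD; first apply: lerD.
  - apply: ler_sum => i _; rewrite ler_wpM2l ?subr_ge0//.
    by rewrite ler_pXn2r ?nnegrE// (le_trans (p0 i)).
  - apply: ler_sum => i _; rewrite ler_wpM2l ?subr_ge0//.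
    by rewrite ler_pXn2r ?nnegrE// (le_trans b0).
  - apply: ler_sum => i _; apply: ler_sum => j _.
    have [s_ge|s_lt] := leP b (s i).
      have -> : p i = b by rewrite /p min_r.
      have := tb j; have [G0|G0] := ger0P (G i j) => tbj.
        have := mulr_ge0 G0 (sqr_ge0 (s i - t j)); lra.
      have -> : - G i j * (b ^+ 2 + b ^+ 2) - 2 * (b * b * G i j) =
        - G i j * (b + b) ^+ 2 by ring.
      have -> : - G i j * (s i ^+ 2 + t j ^+ 2) - 2 * (s i * t j * G i j) =
        - G i j * (s i + t j) ^+ 2 by ring.
      by rewrite ler_wpM2l ?oppr_ge0 ?(ltW G0)// ler_pXn2r ?nnegrE ?addr_ge0//; lra.
    have -> : p i = s i by rewrite /p min_l // ltW.
    have := tb j; have [G0|G0] := ger0P (G i j) => tbj.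
      have -> : G i j * (s i ^+ 2 + b ^+ 2) - 2 * (s i * b * G i j) =
        G i j * (b - s i) ^+ 2 by ring.
      have -> : G i j * (s i ^+ 2 + t j ^+ 2) - 2 * (s i * t j * G i j) =
        G i j * (t j - s i) ^+ 2 by ring.
      by rewrite ler_wpM2l// ler_pXn2r ?nnegrE ?subr_ge0//; lra.
    have -> : - G i j * (s i ^+ 2 + b ^+ 2) - 2 * (s i * b * G i j) =
      - G i j * (s i + b) ^+ 2 by ring.
    have -> : - G i j * (s i ^+ 2 + t j ^+ 2) - 2 * (s i * t j * G i j) =
      - G i j * (s i + t j) ^+ 2 by ring.
    have si : 0 <= s i := le_trans a0 (sa i).
    by rewrite ler_wpM2l ?oppr_ge0 ?(ltW G0)// ler_pXn2r ?nnegrE ?addr_ge0//; lra.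
apply: le_trans clamp.
pose g i := \sum_j G i j.
have g1 i : g i <= 1.
  by apply: le_trans (G_row i); apply: ler_sum => j _; exact: ler_norm.
have -> : \sum_i p i ^+ 2 + \sum_(j < r) b ^+ 2
    - 2 * \sum_i \sum_j p i * b * G i j =
    \sum_i (p i ^+ 2 + b ^+ 2 - 2 * (p i * b) * g i).
  rewrite mulr_sumr -big_split -sumrB; apply: eq_bigr => i _ /=.
  rewrite /g !mulr_sumr; congr (_ - _).
  by apply: eq_bigr => j _; ring.
have pi0 : p i0 = a by rewrite /p si0 min_l.
(* Each summand is (p_i - b)^2 + 2 p_i b (1 - g_i), at least 2ab (1 - g_i); the index i0, where p_i
   = a, supplies the extra (a - b)^2. *)
have : 2 * (a * b) * \sum_i (1 - g i) <=
   \sum_i (p i ^+ 2 + b ^+ 2 - 2 * (p i * b) * g i) - (a - b) ^+ 2.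
  rewrite (bigD1 i0)//= [X in _ <= X - _](bigD1 i0)//= pi0 mulrDr mulr_sumr.
  set S := \sum_(_ | _) _; set S' := \sum_(_ | _) _.
  suff : S <= S' by lra.
  apply: ler_sum => i _.
  have -> : p i ^+ 2 + b ^+ 2 - 2 * (p i * b) * g i =
    (p i - b) ^+ 2 + 2 * (p i * b) * (1 - g i) by ring.
  apply: ler_wpDl; first exact: sqr_ge0.
  by rewrite ler_wpM2r ?subr_ge0// ler_pM2l ?ltr0n// ler_wpM2r.
rewrite sumrB sumr_const card_ord -/(\sum_i g i) => H.
have : 0 <= 2 * (a * b) * (r%:R - 1 + delta - \sum_i g i).
  by rewrite !mulr_ge0// subr_ge0.
by move: H; set S := \sum_i g i; set S' := \sum_i _; lra.
Qed.

(** Exchanging s with t and transposing G reduces to a <= b. It is applied with a, b the smallest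
    singular values and delta = det W. *)
Lemma min_overlap_le s t G (a b delta : R) i0 j0 :
  0 <= a -> 0 <= b -> (forall i, a <= s i) -> s i0 = a ->
  (forall j, b <= t j) -> t j0 = b ->
  (forall i, \sum_j `|G i j| <= 1) -> (forall j, \sum_i `|G i j| <= 1) ->
  \sum_i \sum_j G i j <= r%:R - 1 + delta ->
  a ^+ 2 + b ^+ 2 - 2 * (a * b) * delta <=
  \sum_i s i ^+ 2 + \sum_j t j ^+ 2 - 2 * \sum_i \sum_j s i * t j * G i j.
Proof.
move=> a0 b0 sa sia tb tjb G_row G_col G_sum.
have [ab|/ltW ba] := leP a b.
  by apply: (@min_overlap_le_aux _ _ _ _ _ _ i0) => //; rewrite a0 ab.
rewrite exchange_big/= in G_sum.
have := @min_overlap_le_aux t s (fun i j => G j i) b a delta j0.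
rewrite b0 ba => /(_ isT tb tjb sa G_col G_row G_sum).
have -> : \sum_i \sum_j s i * t j * G i j = \sum_j \sum_i t j * s i * G i j.
  rewrite exchange_big; apply: eq_bigr => j _; apply: eq_bigr => i _.
  by rewrite [s i * _]mulrC.
by move=> H; lra.
Qed.

End OverlapInequalities.

(** * Bounds for the invariants *)

Section PositiveSemidefiniteRoot.
Variable R : realType.

Lemma dotmx_eq0 n (u : 'rV[R]_n) : (u *m u^T) 0 0 = 0 -> u = 0.
Proof. by move=> u0; apply/eqP; apply: contra_eqT u0 => /dotmx_gt0/gt_eqF ->. Qed.

(** The form at x + c (x B) is nonnegative for every c, has no constant term and has linear
    coefficient 2 |x B|^2, which must vanish. *)
Lemma psd_isotropic m (B : 'M[R]_m) (x : 'rV[R]_m) :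
  psdmx B -> (x *m B *m x^T) 0 0 = 0 -> x *m B = 0.
Proof.
move=> [Bsym Bpos] xBx; apply: dotmx_eq0.
pose y := x *m B; set q := (_ *m _) 0 0.
have addE (A A' : 'M[R]_1) : (A + A') 0 0 = A 0 0 + A' 0 0 by rewrite mxE.
have scaleE c (A : 'M[R]_1) : (c *: A) 0 0 = c * A 0 0 by rewrite mxE.
have yBx : (y *m B *m x^T) 0 0 = q by rewrite /q trmx_mul Bsym mulmxA.
have xBy : (x *m B *m y^T) 0 0 = q by [].
set e := (y *m B *m y^T) 0 0.
have e0 : 0 <= e by exact: Bpos.
have H c : 0 <= 2 * c * q + c ^+ 2 * e.
  have := Bpos (x + c *: y).
  rewrite linearD/= linearZ/= mulmxDr !mulmxDl -!scalemxAr -!scalemxAl.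
  rewrite !(addE, scaleE) xBx yBx xBy -/e.
  by congr (0 <= _); ring.
have e1 : 0 < e + 1 by lra.
have := H (- q / (e + 1)).
have -> : 2 * (- q / (e + 1)) * q + (- q / (e + 1)) ^+ 2 * e =
    - ((e + 2) / (e + 1) ^+ 2 * q ^+ 2) by field; rewrite gt_eqF.
rewrite oppr_ge0 => q2; apply/eqP; rewrite -sqrf_eq0 eq_le sqr_ge0 andbT.
rewrite -(pmulr_rle0 _ (_ : 0 < (e + 2) / (e + 1) ^+ 2))//.
by rewrite divr_gt0 ?exprn_gt0//; lra.
Qed.

(** With D = B - C, B D + D C = 0, so the traces of D B D and D C D add up to 0. Their diagonals are
    nonnegative, hence zero; then D B = D C = 0 and D D = 0. *)
Lemma psd_sqr_inj m (B C : 'M[R]_m) :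
  psdmx B -> psdmx C -> B *m B = C *m C -> B = C.
Proof.
move=> Bpsd Cpsd BC; pose D := B - C.
have Dsym : D^T = D by rewrite linearB/= Bpsd.1 Cpsd.1.
have D0 : B *m D + D *m C = 0.
  by rewrite /D mulmxBr mulmxBl BC addrA subrK subrr.
have entry (A : 'M[R]_m) i : (D *m A *m D) i i = (row i D *m A *m (row i D)^T) 0 0.
  by rewrite tr_row Dsym colE mulmxA -colE -!row_mul [RHS]mxE [RHS]mxE.
have entry_ge0 A i : psdmx A -> 0 <= (D *m A *m D) i i.
  by move=> [_ Apos]; rewrite entry.
have sum0 : \sum_i ((D *m B *m D) i i + (D *m C *m D) i i) = 0.
  rewrite big_split/= -/(\tr (D *m B *m D)) -/(\tr (D *m C *m D)).
  rewrite -[D *m B *m D]mulmxA mxtrace_mulC -raddfD/= -mulmxDl D0 mul0mx.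
  exact: mxtrace0.
have diag0 i : (D *m B *m D) i i + (D *m C *m D) i i = 0.
  have /eqP := sum0; rewrite psumr_eq0 => [/allP/(_ i (mem_index_enum i))/eqP//|k _].
  by rewrite addr_ge0 ?entry_ge0.
have DA0 A : psdmx A -> (forall i, (D *m A *m D) i i = 0) -> D *m A = 0.
  move=> Apsd A0; apply/row_matrixP => i; rewrite row_mul row0.
  by apply: psd_isotropic; rewrite -?entry.
have both0 i : (D *m B *m D) i i = 0 /\ (D *m C *m D) i i = 0.
  have := diag0 i.
  have := entry_ge0 B i Bpsd; have := entry_ge0 C i Cpsd.
  by move: (_ i i) (_ i i) => x y *; split; lra.
have DB : D *m B = 0 by apply: DA0 => // i; have [] := both0 i.
have DC : D *m C = 0 by apply: DA0 => // i; have [] := both0 i.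
have DD : D *m D^T = 0 by rewrite Dsym {2}/D mulmxBr DB DC subrr.
apply/eqP; rewrite -subr_eq0 -/D; apply/eqP/row_matrixP => i.
rewrite row0; apply: dotmx_eq0.
by rewrite tr_row colE mulmxA -colE -row_mul DD !mxE.
Qed.

End PositiveSemidefiniteRoot.

Section Invariants.
Local Open Scope classical_set_scope.
Variables (R : realType) (r n : nat).
Implicit Types (X Y : 'M[R]_(r, n)).

Lemma phi_svd X U s V : thin_svd X U s V -> phi X = V^T *m diag_mx s *m V.
Proof.
move=> [[UU _] s0 _ V1 XE].
have VSV : psdmx (V^T *m diag_mx s *m V) /\
    (V^T *m diag_mx s *m V) *m (V^T *m diag_mx s *m V) = X^T *m X.
  split; last first.
    rewrite XE !trmx_mul tr_diag_mx !mulmxA; congr (_ *m _); congr (_ *m _).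
    by rewrite -[LHS]mulmxA V1 -[RHS]mulmxA (mulmx1C UU).
  split; first by rewrite !trmx_mul trmxK tr_diag_mx mulmxA.
  move=> v; rewrite !mulmxA -mulmxA -[V *m v^T]trmxK trmx_mul trmxK mul_mx_diag mxE.
  rewrite sumr_ge0// => i _; rewrite [X in X * _]mxE [X in _ * X]mxE mulrAC.
  by rewrite mulr_ge0// -expr2 sqr_ge0.
rewrite /phi /psd_sqrt; case: xgetP => [B _ [Bpsd BB]|/(_ _ VSV)//].
by apply: psd_sqr_inj VSV.1 _ => //; rewrite BB VSV.2.
Qed.

(** Since decompositions exist, the choice in [psi] returns a value attained by one of them, and
    that same triple also computes [phi]. *)
Lemma invariants_svd X : (r <= n)%N -> exists U s V,
  [/\ thin_svd X U s V, phi X = V^T *m diag_mx s *m V &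
      psi X = sigma_min s *: plucker V].
Proof.
move=> /(thin_svd_exists X)[U0 [s0 [V0 svd0]]].
have [U [s [V [svd E]]]] : [set p | exists U s V,
    thin_svd X U s V /\ p = sigma_min s *: plucker V] (psi X).
  by apply: xgetPex; exists (sigma_min s0 *: plucker V0), U0, s0, V0.
by exists U, s, V; split=> //; exact: phi_svd svd.
Qed.

Lemma plucker_dot (V V' : 'M[R]_(r, n)) :
  \sum_S plucker V S * plucker V' S = \det (V *m V'^T).
Proof.
rewrite cauchy_binet; apply: eq_bigr => S _; rewrite !ffunE; congr (_ * _).
by rewrite -det_tr; congr (\det _); apply/matrixP => i j; rewrite !mxE.
Qed.

Lemma plucker_dist (a b : R) (V V' : 'M[R]_(r, n)) :
  V *m V^T = 1%:M -> V' *m V'^T = 1%:M ->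
  \sum_S ((a *: plucker V) S - (b *: plucker V') S) ^+ 2 =
  a ^+ 2 + b ^+ 2 - 2 * (a * b) * \det (V *m V'^T).
Proof.
move=> V1 V'1.
have := plucker_dot V V; have := plucker_dot V' V'; rewrite V1 V'1 det1 => E' E.
rewrite -[a ^+ 2]mulr1 -[b ^+ 2]mulr1 -{1}E -{1}E' -plucker_dot !mulr_sumr.
rewrite -big_split -sumrB; apply: eq_bigr => S _ /=.
by rewrite !ffunE /GRing.scale/=; ring.
Qed.

(** Positivity of r makes the last entry a genuine one rather than the default 0 of [last]. *)
Lemma sigma_minP (s : 'rV[R]_r) : (0 < r)%N ->
  (forall i j : 'I_r, (i <= j)%N -> s 0 j <= s 0 i) ->
  exists2 k, s 0 k = sigma_min s & forall i, sigma_min s <= s 0 i.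
Proof.
case: r s => // r' s _ sd.
have E : sigma_min s = s 0 ord_max.
  by rewrite /sigma_min /image_mem enum_ordSr map_rcons last_rcons.
by exists ord_max => [//|i]; rewrite E; apply: sd; rewrite -ltnS.
Qed.

End Invariants.

Section InvariantBounds.
Variables (R : realType) (r n : nat).
Implicit Types (X Y V : 'M[R]_(r, n)) (U O Q : 'M[R]_r) (s t : 'rV[R]_r).

Lemma orthogonal_row_sqr O i : O *m O^T = 1%:M -> \sum_j O i j ^+ 2 = 1.
Proof.
move=> /matrixP/(_ i i); rewrite !mxE eqxx mulr1n => <-.
by apply: eq_bigr => j _; rewrite mxE expr2.
Qed.

Lemma orthogonal_col_sqr O j : O *m O^T = 1%:M -> \sum_i O i j ^+ 2 = 1.
Proof.
move=> /mulmx1C O1; rewrite -(@orthogonal_row_sqr O^T j) ?trmxK//.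
by apply: eq_bigr => i _; rewrite mxE.
Qed.

(** Q is absorbed into the left factor of X. The [psi] bound applies [min_overlap_le] to G_ij = O_ij
    W_ij, whose absolute row and column sums are at most 1 by AM-GM. *)
Lemma invariants_upper X Y Q : (0 < r)%N -> (r <= n)%N -> SO Q ->
  frob (phi X - phi Y) ^+ 2 <= 2 * frob (Q *m X - Y) ^+ 2 /\
  \sum_S (psi X S - psi Y S) ^+ 2 <= frob (Q *m X - Y) ^+ 2.
Proof.
move=> r0 rn QSO.
have [U [s [V [[USO s0 sd V1 XE] -> ->]]]] := invariants_svd X rn.
have [U' [t [V' [[U'SO t0 td V'1 YE] -> ->]]]] := invariants_svd Y rn.
have QU : SO (Q *m U) by exact: SOM.
pose O := (Q *m U)^T *m U'.
have OSO : SO O by apply: SOM => //; exact: SOT.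
have O1 := OSO.1; have detO := OSO.2.
have -> : frob (Q *m X - Y) ^+ 2 = \sum_i s 0 i ^+ 2 + \sum_i t 0 i ^+ 2 -
    2 * \sum_i \sum_j s 0 i * t 0 j * (O i j * (V *m V'^T) i j).
  by rewrite XE YE !mulmxA frob_svdB// ?(mulmx1C QU.1) ?(mulmx1C U'SO.1).
split.
  rewrite frob_svdB ?trmxK//; apply: sqrt_overlap_le => //.
  - by move=> i; exact: orthogonal_row_sqr.
  - by move=> j; exact: orthogonal_col_sqr.
rewrite plucker_dist//.
have [k sk s_ge] := sigma_minP r0 sd; have [l tl t_ge] := sigma_minP r0 td.
have amgm (x y : R) : `|x * y| <= 2^-1 * (x ^+ 2 + y ^+ 2).
  rewrite normrM -(real_normK (num_real x)) -(real_normK (num_real y)).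
  by have := sqr_ge0 (`|x| - `|y|); lra.
apply: (min_overlap_le (i0 := k) (j0 := l)) => //.
- by rewrite -sk.
- by rewrite -tl.
- move=> i; apply: (le_trans (ler_sum _ (fun j _ => amgm _ _))).
  rewrite -mulr_sumr big_split/= orthogonal_row_sqr//.
  by have := frame_overlap_row i V1 V'1; lra.
- move=> j; apply: (le_trans (ler_sum _ (fun i _ => amgm _ _))).
  rewrite -mulr_sumr big_split/= orthogonal_col_sqr//.
  by have := frame_overlap_col j V1 V'1; lra.
(* The sum of G is the trace of the overlap of the frames O V' and V; its determinant is det W
   because det O = 1. *)
- rewrite -mxtrace_mul_tr trmx_mul trmxK mulmxA.
  have := frame_overlap_trace (mul_frame O1 V'1) V1.
  rewrite -(mulmxA O) det_mulmx detO mul1r -(det_tr (V' *m V^T)).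
  by rewrite trmx_mul trmxK.
Qed.

Lemma alignment s t V V' : (forall i, 0 <= s 0 i) -> (forall i, 0 <= t 0 i) ->
  V *m V^T = 1%:M -> V' *m V'^T = 1%:M -> 0 <= \det (V *m V'^T) ->
  exists2 O : 'M[R]_r, SO O &
    \sum_i \sum_j s 0 i * t 0 j * ((V *m V'^T) i j * (V *m V'^T) i j) <=
    \sum_i \sum_j s 0 i * t 0 j * (O i j * (V *m V'^T) i j).
Proof.
(* O is the orthogonal polar factor of M = S W T, whose pairing with M is the
   nuclear norm of M, which dominates the pairing with any contraction. *)
move=> s0 t0 V1 V'1 detW; pose W := V *m V'^T.
pose M := diag_mx s *m W *m diag_mx t.
have pairM (N : 'M[R]_r) :
    \sum_i \sum_j s 0 i * t 0 j * (N i j * W i j) = \tr (M *m N^T).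
  rewrite mxtrace_mul_tr; apply: eq_bigr => i _; apply: eq_bigr => j _.
  by rewrite /M mul_mx_diag mul_diag_mx [X in _ = X * _]mxE [X in _ = X * _ * _]mxE; ring.
have [A [d [B [[A1 detA] d0 _ B1 ME]]]] := thin_svd_exists M (leqnn r).
have trM (N : 'M[R]_r) : \tr (M *m N^T) = \sum_i d 0 i * (B *m N^T *m A) i i.
  rewrite ME -!mulmxA mxtrace_mulC -!mulmxA mul_diag_mx !mulmxA.
  by apply: eq_bigr => i _; rewrite mxE.
have boundW : \tr (M *m W^T) <= \sum_i d 0 i.
  rewrite trM; apply: ler_sum => i _; rewrite ler_piMr//.
  have -> : B *m W^T *m A = (B *m V') *m (A^T *m V)^T.
    by rewrite /W !trmx_mul !trmxK !mulmxA.
  apply: frame_overlap_le1; apply: mul_frame => //.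
  by rewrite trmxK (mulmx1C A1).
have [detB|detB] := det_orthogonal B1.
  exists (A *m B); first by apply: SOM.
  rewrite !pairM (le_trans boundW)// trM trmx_mul mulmxA B1 mul1mx (mulmx1C A1).
  by apply: ler_sum => i _; rewrite mxE eqxx mulr1.
(* The polar factor A B now has determinant -1. Since det M >= 0 is minus the product of the d_i,
   some d_k is 0, and flipping that direction costs nothing. *)
have [k dk] : exists k, d 0 k = 0.
  have : 0 <= \det M.
    by rewrite /M !det_mulmx !det_diag !mulr_ge0// prodr_ge0.
  rewrite ME !det_mulmx det_diag detA detB mul1r mulrN1 oppr_ge0 => d_le.
  have /eqP : \prod_i d 0 i = 0 by apply/eqP; rewrite eq_le d_le prodr_ge0.
  by move=> /prodf_eq0[k _ /eqP dk]; exists k.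
exists (A *m flip_mx R k *m B).
  split; last by rewrite !det_mulmx detA detB det_flip_mx mul1r mulrNN mulr1.
  apply: mul_frame => //; apply: mul_frame => //.
  by rewrite flip_mx_tr flip_mxK.
rewrite !pairM (le_trans boundW)// trM !trmx_mul flip_mx_tr.
rewrite !mulmxA B1 mul1mx -mulmxA (mulmx1C A1) mulmx1.
apply: ler_sum => i _; rewrite !mxE eqxx mulr1n.
by have [->|ik] := eqVneq i k; rewrite ?dk ?mul0r// expr0 mulr1.
Qed.

(** Q = U' G^T U^T solves (Q U)^T U' = G with G from [alignment]; both distances share their square
    terms, so only the pairings are compared. *)
Lemma aligned_representative U U' s t V V' :
  SO U -> SO U' -> (forall i, 0 <= s 0 i) -> (forall i, 0 <= t 0 i) ->
  V *m V^T = 1%:M -> V' *m V'^T = 1%:M -> 0 <= \det (V *m V'^T) ->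
  exists2 Q, SO Q &
    frob (Q *m (U *m diag_mx s *m V) - U' *m diag_mx t *m V') ^+ 2 <=
    frob (V^T *m diag_mx s *m V - V'^T *m diag_mx t *m V') ^+ 2.
Proof.
move=> USO U'SO s0 t0 V1 V'1 detW.
have [G GSO H] := alignment s0 t0 V1 V'1 detW.
pose Q := U' *m G^T *m U^T.
have QSO : SO Q by apply: SOM (SOT USO); apply: SOM (SOT GSO).
have QU : SO (Q *m U) by exact: SOM.
exists Q => //; rewrite !mulmxA !frob_svdB ?trmxK ?(mulmx1C QU.1) ?(mulmx1C U'SO.1)//.
have -> : (Q *m U)^T *m U' = G.
  rewrite /Q -mulmxA (mulmx1C USO.1) mulmx1 trmx_mul trmxK -mulmxA.
  by rewrite (mulmx1C U'SO.1) mulmx1.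
by move: H; lra.
Qed.

(* Negating the k-th singular direction of X moves X by 2 s_k, keeps
   phi X and makes the determinant of the overlap nonnegative. *)
Lemma flipped_representative U U' s t V V' k :
  SO U -> SO U' -> (forall i, 0 <= s 0 i) -> (forall i, 0 <= t 0 i) ->
  V *m V^T = 1%:M -> V' *m V'^T = 1%:M -> \det (V *m V'^T) <= 0 ->
  exists2 Q, SO Q &
    frob (Q *m (U *m diag_mx s *m V) - U' *m diag_mx t *m V') ^+ 2 <=
    2 * frob (V^T *m diag_mx s *m V - V'^T *m diag_mx t *m V') ^+ 2
    + 8 * s 0 k ^+ 2.
Proof.
move=> USO U'SO s0 t0 V1 V'1 detW; pose D := flip_mx R k.
have DV1 : (D *m V) *m (D *m V)^T = 1%:M.
  by apply: mul_frame => //; rewrite flip_mx_tr flip_mxK.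
have [|Q QSO H] := aligned_representative USO U'SO s0 t0 DV1 V'1.
  by rewrite -mulmxA det_mulmx det_flip_mx mulN1r oppr_ge0.
exists Q => //.
have <- : (D *m V)^T *m diag_mx s *m (D *m V) = V^T *m diag_mx s *m V.
  have DS : diag_mx s *m D = D *m diag_mx s by exact: diag_mxC.
  rewrite trmx_mul flip_mx_tr !mulmxA -(mulmxA _ (diag_mx s) D) DS !mulmxA.
  by rewrite -(mulmxA _ D D) flip_mxK mulmx1.
set X := U *m diag_mx s *m V; set Y := _ *m V'.
pose X' := U *m diag_mx s *m (D *m V).
(* Passing through the flipped X', the inequality |A + B|^2 <= 2|A|^2 + 2|B|^2 produces the factors
   2 and 8 = 2 * 4. *)
have -> : Q *m X - Y = (Q *m X' - Y) + Q *m (X - X').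
  by rewrite mulmxBr [RHS]addrC subrKA.
apply: (le_trans (frob_sqrD_le _ _)).
have -> : frob (Q *m (X - X')) ^+ 2 = 4 * s 0 k ^+ 2.
  rewrite frob_SO// frob_svdB ?(mulmx1C USO.1)//.
  rewrite trmx_mul flip_mx_tr mulmxA V1 mul1mx.
  have inner i : \sum_j s 0 i * s 0 j * ((1%:M : 'M[R]_r) i j * D i j) =
      s 0 i ^+ 2 * (-1) ^+ (i == k).
    rewrite (bigD1 i)//= big1 => [|j ji]; rewrite !mxE ?eqxx.
      by rewrite !mulr1n mul1r addr0 expr2.
    by rewrite eq_sym (negbTE ji) mul0r mulr0.
  under [X in _ - 2 * X]eq_bigr do rewrite inner.
  rewrite mulr_sumr -big_split -sumrB/= (bigD1 k)//= big1 => [|i ik].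
    by rewrite eqxx expr1; ring.
  by rewrite (negbTE ik) expr0; ring.
by move: H; rewrite -/X' -/Y; lra.
Qed.

Lemma invariants_lower X Y : (0 < r)%N -> (r <= n)%N ->
  exists2 Q, SO Q &
    frob (Q *m X - Y) ^+ 2 <=
    2 * (frob (phi X - phi Y) ^+ 2 + 2 * \sum_S (psi X S - psi Y S) ^+ 2).
Proof.
move=> r0 rn.
have [U [s [V [[USO s0 sd V1 XE] -> ->]]]] := invariants_svd X rn.
have [U' [t [V' [[U'SO t0 td V'1 YE] -> ->]]]] := invariants_svd Y rn.
have psi_ge0 : 0 <= \sum_S ((sigma_min s *: plucker V) S -
    (sigma_min t *: plucker V') S) ^+ 2.
  by apply: sumr_ge0 => S _; exact: sqr_ge0.
rewrite {1}XE {1}YE; set f := frob (V^T *m _ *m _ - _).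
have [detW|/ltW detW] := leP 0 (\det (V *m V'^T)).
  have [Q QSO H] := aligned_representative USO U'SO s0 t0 V1 V'1 detW.
  exists Q => //; apply: (le_trans H); rewrite -/f.
  by have := sqr_ge0 f; lra.
rewrite plucker_dist//.
have [k sk _] := sigma_minP r0 sd; have [l tl _] := sigma_minP r0 td.
rewrite -sk -tl; have sk0 := s0 k; have tl0 := t0 l.
have st : 0 <= - (s 0 k * t 0 l * \det (V *m V'^T)).
  by rewrite -mulrN !mulr_ge0// oppr_ge0.
(* Flipping the smaller of the two values costs 8 min^2. As det W <= 0, the squared [psi] distance
   is at least s_k^2 + t_l^2 >= 2 min^2, and its coefficient 4 absorbs the cost. *)
have [st_le|/ltW ts_le] := leP (s 0 k) (t 0 l).
  have [Q QSO H] := flipped_representative k USO U'SO s0 t0 V1 V'1 detW.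
  exists Q => //; apply: (le_trans H); rewrite -/f.
  have : s 0 k ^+ 2 <= t 0 l ^+ 2 by rewrite ler_pXn2r.
  by move: st; lra.
have detW' : \det (V' *m V^T) <= 0 by rewrite -det_tr trmx_mul trmxK.
have [Q QSO H] := flipped_representative l U'SO USO t0 s0 V'1 V1 detW'.
(* Here Q aligns Y to X, so its inverse aligns X to Y. *)
exists Q^T; first exact: SOT.
rewrite -(frob_SO _ QSO) mulmxBr (mulmxA Q Q^T) QSO.1 mul1mx frobC.
apply: (le_trans H); rewrite frobC -/f.
have : t 0 l ^+ 2 <= s 0 k ^+ 2 by rewrite ler_pXn2r.
by move: st; lra.
Qed.

End InvariantBounds.

(** * Distortion *)

Section DistortionBounds.
Local Open Scope classical_set_scope.
Variables (R : realType) (X Y : Type).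
Variables (dX : X -> X -> R) (dY : Y -> Y -> R) (f : X -> Y).

Lemma distortion_le (a b : R) : 0 < a -> 0 <= b ->
  (forall x x', a * dX x x' <= dY (f x) (f x')) ->
  (forall x x', dY (f x) (f x') <= b * dX x x') ->
  (distortion dX dY f <= (b / a)%:E)%E.
Proof.
move=> a0 b0 ale leb; rewrite /distortion.
have la : (a%:E <= lower_lip dX dY f)%E.
  apply: ereal_sup_ubound; split; first by rewrite lee_fin ltW.
  by move=> x x'; rewrite -EFinM lee_fin.
have ub : (upper_lip dX dY f <= b%:E)%E.
  apply: ereal_inf_lbound; split; first by rewrite lee_fin.
  by move=> x x'; rewrite -EFinM lee_fin.
have u0 : (0 <= upper_lip dX dY f)%E.
  by apply: le_ereal_inf_tmp => y [].
have lN0 : (lower_lip dX dY f == 0)%E = false.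
  by apply/negbTE; rewrite gt_eqF// (lt_le_trans _ la)// lte_fin.
have uNy : (upper_lip dX dY f == +oo)%E = false.
  by apply/negbTE; rewrite lt_eqF// (le_lt_trans ub)// ltry.
rewrite lN0 uNy /= EFinM; apply: lee_pmul => //.
  by rewrite inve_ge0 (le_trans _ la)// lee_fin ltW.
have -> : (a^-1)%:E = (a%:E^-1)%E by rewrite inver gt_eqF.
rewrite lee_pV2// inE; last by rewrite lee_fin ltW.
by rewrite (le_trans _ la)// lee_fin ltW.
Qed.

(** This reduces the extended-real quotient to finite constants: two points at positive distance
    exclude an infinite lower constant. *)
Lemma distortion_ge (c : R) : 0 < c -> (forall y y', 0 <= dY y y') ->
  (exists x x', 0 < dX x x') ->
  (forall a b, 0 <= a -> 0 <= b ->
    (forall x x', a * dX x x' <= dY (f x) (f x')) ->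
    (forall x x', dY (f x) (f x') <= b * dX x x') -> c * a <= b) ->
  (c%:E <= distortion dX dY f)%E.
Proof.
move=> c0 dY_ge0 [x [x' dxx']] cab; rewrite /distortion.
case: ifPn => [_|]; first by rewrite leey.
rewrite negb_or => /andP[lN0 uNy].
have l_ge0 : (0 <= lower_lip dX dY f)%E.
  by apply: ereal_sup_ubound; split=> // y y'; rewrite mul0e lee_fin.
have cl b : (0 <= b)%E ->
    (forall x x', ((dY (f x) (f x'))%:E <= b * (dX x x')%:E)%E) ->
    (lower_lip dX dY f <= (c^-1)%:E * b)%E.
  case: b => [b||//]; last first.
    by move=> _ _; rewrite gt0_muley ?lte_fin ?invr_gt0// leey.
  rewrite lee_fin => b0 leb; apply: ge_ereal_sup => -[a||] /= [a_ge0 ale] //.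
    rewrite -EFinM lee_fin mulrC ler_pdivlMr// mulrC; exact: cab.
  by have := ale x x'; rewrite gt0_mulye ?lte_fin.
have lu : (lower_lip dX dY f <= (c^-1)%:E * upper_lip dX dY f)%E.
  have u_ge0 : (0 <= upper_lip dX dY f)%E by apply: le_ereal_inf_tmp => y [].
  rewrite muleC -lee_pdivrMr ?invr_gt0//; apply: le_ereal_inf_tmp => b [b0 leb].
  by rewrite lee_pdivrMr ?invr_gt0// muleC; exact: cl.
have u_fin : upper_lip dX dY f \is a fin_num.
  by rewrite ge0_fin_numE ?lt_neqAle ?uNy ?leey//; apply: le_ereal_inf_tmp => y [].
have l_fin : lower_lip dX dY f \is a fin_num.
  by rewrite ge0_fin_numE// (le_lt_trans lu)// -(fineK u_fin) -EFinM ltry.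
have l_gt0 : (0 < lower_lip dX dY f)%E by rewrite lt_def lN0.
move: lu l_gt0; rewrite -(fineK u_fin) -(fineK l_fin); move: (fine _) (fine _) => u l.
rewrite -EFinM lee_fin lte_fin => lu l_gt0.
rewrite inver gt_eqF// -EFinM lee_fin ler_pdivlMr//.
by move: lu; rewrite mulrC ler_pdivlMr// mulrC.
Qed.

End DistortionBounds.

Section QuotientDistortion.
Local Open Scope classical_set_scope.
Variables (R : realType) (r n : nat).
Hypotheses (r_gt0 : (0 < r)%N) (r_le_n : (r <= n)%N).
Implicit Types a b : SO_quot R r n.

Lemma quot_dist_le a b (Q : 'M[R]_r) :
  SO Q -> quot_dist a b <= frob (Q *m repr a - repr b).
Proof.
move=> QSO; apply: ge_inf; last by exists Q.
by exists 0 => _ [P _ <-]; exact: frob_ge0.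
Qed.

Lemma le_quot_dist a b (m : R) :
  (forall Q : 'M[R]_r, SO Q -> m <= frob (Q *m repr a - repr b)) ->
  m <= quot_dist a b.
Proof.
move=> H; apply: lb_le_inf; last by move=> _ [Q QSO <-]; exact: H.
by exists (frob (1%:M *m repr a - repr b)), 1%:M => //; exact: SO1.
Qed.

Lemma cod_dist_sqr a b : cod_dist (F a) (F b) ^+ 2 =
  frob (phi (repr a) - phi (repr b)) ^+ 2 +
  2 * \sum_S (psi (repr a) S - psi (repr b) S) ^+ 2.
Proof.
rewrite sqr_sqrtr ?addr_ge0 ?sqr_ge0//=; last first.
  by apply: sumr_ge0 => S _; exact: sqr_ge0.
congr (_ + _); rewrite mulr_sumr; apply: eq_bigr => S _.
rewrite /F /= !ffunE /GRing.scale/=.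
by rewrite -mulrBr exprMn sqr_sqrtr.
Qed.

(** After squaring, [phi] contributes 2 and [psi] contributes 1 doubled by its weight, for a total
    of 4. *)
Lemma F_upper a b : cod_dist (F a) (F b) <= 2 * quot_dist a b.
Proof.
rewrite -ler_pdivrMl//; apply: le_quot_dist => Q QSO; rewrite ler_pdivrMl//.
rewrite -(ler_pXn2r (n := 2)) ?nnegrE ?mulr_ge0 ?frob_ge0 ?sqrtr_ge0//.
rewrite cod_dist_sqr exprMn.
have [] := invariants_upper (repr a) (repr b) r_gt0 r_le_n QSO.
by lra.
Qed.

Lemma F_lower a b : (Num.sqrt 2)^-1 * quot_dist a b <= cod_dist (F a) (F b).
Proof.
have s2 : 0 < Num.sqrt 2 :> R by rewrite sqrtr_gt0.
rewrite ler_pdivrMl//.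
have [Q QSO H] := invariants_lower (repr a) (repr b) r_gt0 r_le_n.
apply: (le_trans (quot_dist_le _ _ QSO)).
rewrite -(ler_pXn2r (n := 2)) ?nnegrE ?mulr_ge0 ?frob_ge0 ?sqrtr_ge0//.
by rewrite exprMn cod_dist_sqr [Num.sqrt 2 ^+ 2]sqr_sqrtr.
Qed.

Lemma F_distortion :
  (distortion (@quot_dist R r n) (@cod_dist R r n) (@F R r n)
     <= (2 * Num.sqrt 2)%:E)%E.
Proof.
rewrite -[Num.sqrt 2]invrK; apply: distortion_le => //.
- exact: F_lower.
- exact: F_upper.
Qed.

Definition cod_index : finType := (('I_n * 'I_n) + colset r n)%type.

(** An isometry into a Hilbert space, which makes [F] a competitor in the infimum defining c_2. *)
Definition cod_flatten (y : 'M[R]_n * {ffun colset r n -> R}) :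
    euclid R cod_index :=
  [ffun i => match i with inl ij => y.1 ij.1 ij.2 | inr c => y.2 c end].

Lemma cod_flatten_dist y z : `|cod_flatten y - cod_flatten z| = cod_dist y z.
Proof.
rewrite /cod_dist frob_sqr; congr Num.sqrt; rewrite /ffdot big_sumType/=.
congr (_ + _).
  by rewrite pair_bigA; apply: eq_bigr => -[i j] _ /=; rewrite !ffunE !mxE expr2.
by apply: eq_bigr => S _; rewrite !ffunE expr2.
Qed.

Lemma euclidean_distortion_le :
  (euclidean_distortion (@quot_dist R r n) <= (2 * Num.sqrt 2)%:E)%E.
Proof.
apply: le_trans F_distortion; apply: ereal_inf_lbound.
exists (euclid R cod_index), (@euclid_dot R cod_index), (cod_flatten \o @F R r n).
split; first by move=> u; exact: esym (ffnorm_sqr u).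
suff -> : @cod_dist R r n = fun y z => `|cod_flatten y - cod_flatten z| by [].
by apply/funext => y; apply/funext => z; rewrite cod_flatten_dist.
Qed.

End QuotientDistortion.

(** * Lower bound for the Euclidean distortion *)

Section PeriodicInequality.
Variables (R : realType) (H : normedModType R) (ip : {dot H for idfun}).
Hypothesis ipE : forall u : H, ip u u = `|u| ^+ 2.

Lemma ip_sym u v : ip u v = ip v u.
Proof. by rewrite hermC expr0 mul1r. Qed.

Lemma ip_ge0 u : 0 <= ip u u.
Proof. by rewrite ipE sqr_ge0. Qed.

Lemma ip_addr u v w : ip u (v + w) = ip u v + ip u w.
Proof. exact: linearDr. Qed.

Lemma ip_addl u v w : ip (u + v) w = ip u w + ip v w.
Proof. exact: linearDl. Qed.

Lemma ip_scaler c u v : ip u (c *: v) = c * ip u v.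
Proof. exact: linearZr_LR. Qed.

Lemma ip_scalel c u v : ip (c *: u) v = c * ip u v.
Proof. exact: linearZl_LR. Qed.

Lemma ip_normB u v : ip (u - v) (u - v) = ip u u + ip v v - 2 * ip u v.
Proof. by rewrite linearBl !linearBr/= (ip_sym v u); ring. Qed.

Lemma ip_parallelogram u v :
  ip (u + v) (u + v) + ip (u - v) (u - v) = 2 * ip u u + 2 * ip v v.
Proof. by rewrite ip_normB !(ip_addl, ip_addr) (ip_sym v u); ring. Qed.

Lemma ip_second_difference (c : R) u v w :
  ip (u + w - (2 * c) *: v) (u + w - (2 * c) *: v) =
  ip u u + ip w w + 4 * c ^+ 2 * ip v v + 2 * ip u w
  - 4 * c * ip u v - 4 * c * ip v w.
Proof.
rewrite ip_normB !(ip_addl, ip_addr) !ip_scaler ip_scalel (ip_sym w u) (ip_sym w v).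
by ring.
Qed.

Lemma sum_shift (g : nat -> R) N m : (forall i, g (i + N)%N = g i) ->
  \sum_(i < N) g (i + m)%N = \sum_(i < N) g i.
Proof.
move=> gN; elim: m => [|m IH]; first by apply: eq_bigr => i _; rewrite addn0.
case: N gN IH => [|N] gN IH; first by rewrite !big_ord0.
rewrite -{}IH [RHS]big_ord_recl big_ord_recr/= addrC; congr (_ + _).
  by rewrite -(gN m) addnC addnS -addSn addnC.
by apply: eq_bigr => i _; congr g; rewrite /bump /= add1n addnS addSn.
Qed.

Variables (N : nat) (y : nat -> H).
Hypothesis y_anti : forall i, y (i + N)%N = - y i.

(** Half a period is enough: after N steps both arguments change sign and the summand repeats. *)
Definition autocorr h : R := \sum_(i < N) ip (y i) (y (i + h)%N).

Lemma autocorr_shift h m :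
  \sum_(i < N) ip (y (i + m)%N) (y (i + m + h)%N) = autocorr h.
Proof.
rewrite (sum_shift (g := fun i => ip (y i) (y (i + h)%N)))// => i.
by rewrite addnAC !y_anti linearNl linearNr/= opprK.
Qed.

(** Shifting by m turns <y_i, y_(i+m)> into <y_(i+m), -y_i>, so the sum is its own opposite. *)
Lemma autocorr_half m : N = (m + m)%N -> autocorr m = 0.
Proof.
move=> Nm; suff : autocorr m = - autocorr m by lra.
rewrite -{1}(autocorr_shift m m) -sumrN; apply: eq_bigr => i _.
by rewrite -addnA -Nm y_anti linearNr/= ip_sym.
Qed.

(* Summing |y_i + y_(i+2h) - 2c y_(i+h)|^2 >= 0 over a period gives the half-angle
   step from 2c^2 - 1 to c. *)
Lemma autocorr_double (c : R) h : 0 < c ->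
  autocorr (h + h) <= (2 * c ^+ 2 - 1) * autocorr 0 ->
  autocorr h <= c * autocorr 0.
Proof.
move=> c0 H2h.
have : 0 <= 2 * autocorr 0 + 4 * c ^+ 2 * autocorr 0 + 2 * autocorr (h + h)
    - 8 * c * autocorr h.
  have -> : 2 * autocorr 0 + 4 * c ^+ 2 * autocorr 0 + 2 * autocorr (h + h)
      - 8 * c * autocorr h =
    \sum_(i < N) ip (y i + y (i + (h + h))%N - (2 * c) *: y (i + h)%N)
                    (y i + y (i + (h + h))%N - (2 * c) *: y (i + h)%N).
    under eq_bigr do rewrite ip_second_difference.
    rewrite !sumrB !big_split/= -!mulr_sumr.
    have e1 : \sum_(i < N) ip (y i) (y i) = autocorr 0.
      by apply: eq_bigr => i _; rewrite addn0.
    have e2 : \sum_(i < N) ip (y (i + (h + h))%N) (y (i + (h + h))%N) = autocorr 0.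
      by rewrite -(autocorr_shift 0 (h + h)); apply: eq_bigr => i _; rewrite addn0.
    have e3 : \sum_(i < N) ip (y (i + h)%N) (y (i + h)%N) = autocorr 0.
      by rewrite -(autocorr_shift 0 h); apply: eq_bigr => i _; rewrite addn0.
    have e4 : \sum_(i < N) ip (y (i + h)%N) (y (i + (h + h))%N) = autocorr h.
      by rewrite -(autocorr_shift h h); apply: eq_bigr => i _; rewrite addnA.
    rewrite e1 e2 e3 e4 -/(autocorr (h + h)) -/(autocorr h).
    by ring.
  by apply: sumr_ge0 => i _; exact: ip_ge0.
move=> L; have : 0 <= 8 * c * (c * autocorr 0 - autocorr h) by move: L H2h; lra.
by rewrite pmulr_rge0 ?subr_ge0// mulr_gt0.
Qed.

End PeriodicInequality.

Section HalfAngles.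
Variable R : realType.

Definition dyadic_cos k : R := cos (pi / 2 ^+ k).

Lemma dyadic_cos_double k : dyadic_cos k = 2 * dyadic_cos k.+1 ^+ 2 - 1.
Proof.
rewrite /dyadic_cos -(_ : (pi / 2 ^+ k.+1) *+ 2 = pi / 2 ^+ k); last first.
  by rewrite exprS -mulr_natr; field; rewrite expf_neq0.
by rewrite cos_mulr2n -mulr_natr mulrC.
Qed.

Lemma dyadic_cos_gt0 k : 0 < dyadic_cos k.+2.
Proof.
apply: cos_gt0_pihalf; rewrite (@lt_le_trans _ _ 0) ?oppr_lt0 ?divr_gt0 ?pi_gt0//=.
  rewrite ltr_pM2l ?pi_gt0// ltf_pV2 ?posrE ?exprn_gt0// exprS ltr_pMr//.
  by rewrite exprn_egt1// ltr1n.
by rewrite divr_ge0 ?pi_ge0// exprn_ge0.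
Qed.

Lemma dyadic_cos1 : dyadic_cos 1 = 0.
Proof. by rewrite /dyadic_cos expr1 cos_pihalf. Qed.

Lemma dyadic_cos_ge0 k : 0 <= dyadic_cos k.+1.
Proof. by case: k => [|k]; rewrite ?dyadic_cos1// ltW// dyadic_cos_gt0. Qed.

Lemma dyadic_cos_lt1 k : dyadic_cos k < 1.
Proof.
elim: k => [|k IH]; first by rewrite /dyadic_cos expr0 divr1 cospi; lra.
have := dyadic_cos_double k; have := dyadic_cos_ge0 k; nra.
Qed.

(** If c' is the half-angle cosine of c, then 1 - c = 2 (1 - c')(1 + c') >= 2 (1 - c') as c' >= 0,
    so the gap to 1 at least halves. *)
Lemma dyadic_cos_cvg k : 1 - dyadic_cos k.+1 <= 2 ^- k.
Proof.
elim: k => [|k IH]; first by rewrite dyadic_cos1 expr0 invr1 subr0.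
have H : 1 - dyadic_cos k.+2 <= 2^-1 * (1 - dyadic_cos k.+1).
  have := dyadic_cos_double k.+1; have := dyadic_cos_ge0 k.+1.
  by have := dyadic_cos_lt1 k.+2; nra.
by apply: (le_trans H); rewrite exprS invfM ler_pM2l.
Qed.

(** Passage to the limit: a positive gap 2x - z would stay below x / 2^k for every k. *)
Lemma le_of_dyadic (x z : R) : 0 <= x ->
  (forall k, (1 + dyadic_cos k.+1) * x <= z) -> 2 * x <= z.
Proof.
move=> x0 xz; rewrite leNgt; apply/negP => zx.
pose d := 2 * x - z; have d0 : 0 < d by rewrite subr_gt0.
have dk k : d <= 2 ^- k * x.
  have := xz k; have := ler_wpM2r x0 (dyadic_cos_cvg k); rewrite /d; lra.
pose k := Num.bound (x / d).
have : x / d < k%:R by rewrite /k archi_boundP// divr_ge0// ltW.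
have k2 : k%:R <= 2 ^+ k :> R.
  by rewrite -natrX ler_nat ltnW// ltn_expl.
move=> /lt_le_trans/(_ k2); rewrite ltr_pdivrMr// => xk.
by have := dk k; rewrite ler_pdivlMl ?exprn_gt0//; lra.
Qed.

End HalfAngles.

Section PeriodicDistortion.
Variables (R : realType) (H : normedModType R) (ip : {dot H for idfun}).
Hypothesis ipE : forall u : H, ip u u = `|u| ^+ 2.

(** The discrete Wirtinger inequality: half-angle steps descend from lag 2^k, a quarter period with
    zero autocorrelation and cosine, to lag 1. *)
Lemma autocorr1_le k (y : nat -> H) :
  (forall i, y (i + 2 ^ k.+1)%N = - y i) ->
  autocorr ip (2 ^ k.+1) y 1 <= dyadic_cos R k.+1 * autocorr ip (2 ^ k.+1) y 0.
Proof.
move=> y_anti.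
have aux j : (j <= k)%N ->
    autocorr ip (2 ^ k.+1) y (2 ^ (k - j)) <=
    dyadic_cos R j.+1 * autocorr ip (2 ^ k.+1) y 0.
  elim: j => [_|j IH jk].
    rewrite subn0 dyadic_cos1 mul0r (autocorr_half _ y_anti)//.
    by rewrite expnS mul2n addnn.
  apply: (autocorr_double ipE y_anti) => //; first exact: dyadic_cos_gt0.
  rewrite -dyadic_cos_double addnn -mul2n -expnS -subSn//= subSS.
  exact/IH/ltnW.
by have := aux k (leqnn k); rewrite subnn expn0.
Qed.

(** The differences y_i of opposite vertices of the closed 2N-gon are antiperiodic. Wirtinger bounds
    their size, at least sqrt 2 a, by their increments, which are controlled by the edges. *)
Lemma cycle_distortion k (x : nat -> H) (a b : R) :
  (forall i, x (i + 2 ^ k.+1 + 2 ^ k.+1)%N = x i) ->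
  (forall i, 2 * a ^+ 2 <= `|x i - x (i + 2 ^ k.+1)%N| ^+ 2) ->
  (forall i, `|x i - x i.+1| ^+ 2 <= b ^+ 2 * (2 - 2 * dyadic_cos R k.+2)) ->
  (1 + dyadic_cos R k.+2) * a ^+ 2 <= b ^+ 2.
Proof.
move=> x_per x_far x_near; set N := (2 ^ k.+1)%N in x_per x_far.
pose y i := x i - x (i + N)%N.
have y_anti i : y (i + N)%N = - y i by rewrite /y x_per opprB.
have S1 := autocorr1_le y_anti; rewrite -/N in S1.
set c := dyadic_cos R k.+2 in x_near *.
have cE : dyadic_cos R k.+1 = 2 * c ^+ 2 - 1 by exact: dyadic_cos_double.
have c1 : c < 1 by exact: dyadic_cos_lt1.
have c0 : 0 < c by exact: dyadic_cos_gt0.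
have N0 : 0 < N%:R :> R by rewrite ltr0n expn_gt0.
have S0 : N%:R * (2 * a ^+ 2) <= autocorr ip N y 0.
  rewrite mulr_natl -[N in leLHS]card_ord -sumr_const; apply: ler_sum => i _.
  by rewrite addn0 ipE; exact: x_far.
(* The increment is a difference of two edges, so its square is at most 2|u|^2 + 2|v|^2. *)
have step i : ip (y i - y i.+1) (y i - y i.+1) <= b ^+ 2 * (8 - 8 * c).
  pose u := x i - x i.+1; pose v := x (i + N)%N - x (i.+1 + N)%N.
  have -> : y i - y i.+1 = u - v.
    rewrite /y /u /v !opprB addrACA [X in _ + X]addrC addrACA.
    by congr (_ + _); rewrite addrC.
  have := ip_ge0 ipE (u + v).
  have := ip_parallelogram ip u v.
  rewrite !(ipE u) !(ipE v).
  by have := x_near i; have := x_near (i + N)%N; rewrite -addSn -/u -/v; lra.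
have E : \sum_(i < N) ip (y i - y i.+1) (y i - y i.+1) =
    2 * autocorr ip N y 0 - 2 * autocorr ip N y 1.
  under eq_bigr do rewrite ip_normB.
  rewrite sumrB big_split/= -mulr_sumr.
  have -> : \sum_(i < N) ip (y i) (y i.+1) = autocorr ip N y 1.
    by apply: eq_bigr => i _; rewrite addn1.
  have -> : \sum_(i < N) ip (y i.+1) (y i.+1) = autocorr ip N y 0.
    rewrite -(autocorr_shift ip y_anti 0 1); apply: eq_bigr => i _.
    by rewrite addn0 addn1.
  have -> : \sum_(i < N) ip (y i) (y i) = autocorr ip N y 0.
    by apply: eq_bigr => i _; rewrite addn0.
  by ring.
have : \sum_(i < N) ip (y i - y i.+1) (y i - y i.+1) <= N%:R * (b ^+ 2 * (8 - 8 * c)).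
  by rewrite mulr_natl -[N in leRHS]card_ord -sumr_const; apply: ler_sum.
rewrite {}E => E.
have : 4 * (1 - c ^+ 2) * (N%:R * (2 * a ^+ 2)) <= N%:R * (b ^+ 2 * (8 - 8 * c)).
  apply: le_trans E; apply: le_trans (_ : 4 * (1 - c ^+ 2) * autocorr ip N y 0 <= _).
    by rewrite ler_wpM2l// mulr_ge0//; nra.
  by move: S1; rewrite cE; lra.
rewrite -subr_ge0 => Z.
(* The polygon closes after angle pi instead of 2 pi, so Wirtinger involves the doubled angle; 1 -
   c^2 then leaves the factor 1 + c, which tends to 2. *)
have : 0 <= (8 * N%:R * (1 - c)) * (b ^+ 2 - (1 + c) * a ^+ 2) by move: Z; lra.
by rewrite pmulr_rge0 ?subr_ge0// !mulr_gt0// subr_gt0.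
Qed.

End PeriodicDistortion.

Section RankOneCircle.
Local Open Scope classical_set_scope.
Local Open Scope quotient_scope.
Variables (R : realType) (r n : nat).
Variables (i0 i1 : 'I_r) (j0 j1 : 'I_n).
Hypotheses (i01 : i0 != i1) (j01 : j0 != j1).

Definition circle_mx (t : R) : 'M[R]_(r, n) :=
  cos t *: delta_mx i0 j0 + sin t *: delta_mx i0 j1.

Definition circle_pt (t : R) : SO_quot R r n := \pi_(SO_quot R r n) (circle_mx t).

Lemma circle_mx_gram s t :
  circle_mx s *m (circle_mx t)^T = cos (s - t) *: delta_mx i0 i0.
Proof.
rewrite /circle_mx linearD/= !linearZ/= !trmx_delta mulmxDl !mulmxDr.
rewrite -!scalemxAl -!scalemxAr !mul_delta_mx_cond !eqxx (negbTE j01).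
rewrite eq_sym (negbTE j01) !mulr0n !mulr1n !scaler0 addr0 add0r.
by rewrite !scalerA -scalerDl cosB.
Qed.

Lemma frob_circle (Q : 'M[R]_r) s t : SO Q ->
  frob (Q *m circle_mx s - circle_mx t) ^+ 2 = 2 - 2 * (cos (s - t) * Q i0 i0).
Proof.
move=> QSO; rewrite frob_sqrB frob_SO// !frob_sqr_trace -mulmxA !circle_mx_gram.
have trE (B : 'M[R]_r) : \tr (B *m delta_mx i0 i0) = B i0 i0.
  rewrite -(mul_delta_mx (0 : 'I_1)) mulmxA mxtrace_mulC mulmxA trace_mx11.
  by rewrite -rowE -colE !mxE.
rewrite -scalemxAr !mxtraceZ trE -[delta_mx i0 i0]mul1mx trE mxE eqxx.
by rewrite !subrr cos0 mulr1n; ring.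
Qed.

Lemma circle_pt_near s t :
  quot_dist (circle_pt s) (circle_pt t) ^+ 2 <= 2 - 2 * cos (s - t).
Proof.
have E := frob_circle s t (@SO1 R r).
have : quot_dist (circle_pt s) (circle_pt t) <= frob (1%:M *m circle_mx s - circle_mx t).
  rewrite quot_dist_pi; apply: ge_inf; last by exists 1%:M => //; exact: SO1.
  by exists 0 => _ [Q _ <-]; exact: frob_ge0.
have d0 : 0 <= quot_dist (circle_pt s) (circle_pt t).
  by apply: le_quot_dist => Q _; exact: frob_ge0.
rewrite -(ler_pXn2r (n := 2)) ?nnegrE ?frob_ge0// E mxE eqxx mulr1n mulr1.
by apply.
Qed.

(** For orthogonal rows the term depending on Q vanishes, so every rotation gives exactly sqrt 2. *)
Lemma circle_pt_far s t : cos (s - t) = 0 ->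
  Num.sqrt 2 <= quot_dist (circle_pt s) (circle_pt t).
Proof.
move=> st; rewrite quot_dist_pi; apply: lb_le_inf.
  by exists (frob (1%:M *m circle_mx s - circle_mx t)), 1%:M => //; exact: SO1.
move=> _ [Q QSO <-].
rewrite -(ler_pXn2r (n := 2)) ?nnegrE ?frob_ge0 ?sqrtr_ge0// frob_circle//.
by rewrite st mul0r mulr0 subr0 [Num.sqrt 2 ^+ 2]sqr_sqrtr.
Qed.

(** Negating row i0 alone has determinant -1; also negating the zero row i1 restores determinant 1.
    This is where r >= 2 enters. *)
Lemma circle_pt_antipodal t : circle_pt (t + pi) = circle_pt t.
Proof.
apply/esym/eqmodP/asboolP; exists (flip_mx R i0 *m flip_mx R i1).
  split; last by rewrite det_mulmx !det_flip_mx mulrNN mulr1.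
  by apply: mul_frame; rewrite flip_mx_tr flip_mxK.
apply/matrixP => i j; rewrite -mulmxA /flip_mx !mul_diag_mx !mxE cosDpi sinDpi.
have [->|ii0] := eqVneq i i0; last by rewrite /= !mulr0 addr0 !mulr0.
by rewrite (negbTE i01) expr0 expr1 mul1r mulN1r !mulNr opprD.
Qed.

Lemma circle_distortion (H : normedModType R) (ip : {dot H for idfun})
    (f : SO_quot R r n -> H) :
  (forall u : H, ip u u = `|u| ^+ 2) ->
  ((Num.sqrt 2)%:E <=
    distortion (@quot_dist R r n) (fun u v : H => `|u - v|%R) f)%E.
Proof.
move=> ipE; apply: distortion_ge => //.
  exists (circle_pt (pi / 2)), (circle_pt 0).
  apply: lt_le_trans (circle_pt_far _); first by rewrite sqrtr_gt0.
  by rewrite subr0 cos_pihalf.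
move=> a b a0 b0 ale leb.
suff : 2 * a ^+ 2 <= b ^+ 2.
  move=> H2; rewrite -(ler_pXn2r (n := 2)) ?nnegrE ?mulr_ge0 ?sqrtr_ge0//.
  by rewrite exprMn [Num.sqrt 2 ^+ 2]sqr_sqrtr.
have key k : (1 + dyadic_cos R k.+2) * a ^+ 2 <= b ^+ 2.
  (* N steps of angle th make a quarter turn, to a point at distance sqrt 2, and 2N steps make a
     half turn, back to the same orbit. *)
  pose N := (2 ^ k.+1)%N; pose th : R := pi / 2 ^+ k.+2.
  have NE : N%:R = 2 ^+ k.+1 :> R by rewrite /N natrX.
  have Nth : N%:R * th = pi / 2.
    rewrite NE /th [2 ^+ k.+2]exprS; field.
    by rewrite expf_neq0.
  apply: (cycle_distortion ipE (x := fun i : nat => f (circle_pt (i%:R * th)))) => i.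
  - rewrite -addnA natrD mulrDl natrD mulrDl -/N Nth.
    by rewrite -mulrDl -mulr2n -(mulr_natr pi) mulfK// circle_pt_antipodal.
  - rewrite (natrD _ i) (mulrDl i%:R) -/N Nth.
    have d2 : Num.sqrt 2 <=
        quot_dist (circle_pt (i%:R * th)) (circle_pt (i%:R * th + pi / 2)).
      by apply: circle_pt_far; rewrite opprD addrA subrr sub0r cosN cos_pihalf.
    apply: le_trans (_ : (a * Num.sqrt 2) ^+ 2 <= _).
      by rewrite exprMn [Num.sqrt 2 ^+ 2]sqr_sqrtr// mulrC.
    rewrite ler_pXn2r ?nnegrE ?mulr_ge0 ?sqrtr_ge0//.
    by apply: le_trans (ale _ _); rewrite ler_wpM2l.
  - set d := quot_dist (circle_pt (i%:R * th)) (circle_pt (i.+1%:R * th)).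
    have d0 : 0 <= d.
      by apply: le_quot_dist => Q _; exact: frob_ge0.
    apply: le_trans (_ : (b * d) ^+ 2 <= _).
      by rewrite ler_pXn2r ?nnegrE ?mulr_ge0.
    rewrite exprMn ler_wpM2l ?sqr_ge0//; apply: (le_trans (circle_pt_near _ _)).
    rewrite -mulrBl -[i.+1%:R]natr1 opprD addrA subrr sub0r mulN1r cosN.
    by rewrite /dyadic_cos.
apply: le_of_dyadic; first exact: sqr_ge0.
(* [key] starts at the second dyadic cosine; the first one is 0, so its inequality is weaker than
   [key 0]. *)
case=> [|k]; last exact: key.
apply: le_trans (key 0); rewrite ler_wpM2r ?sqr_ge0// dyadic_cos1.
by rewrite lerD2l ltW// dyadic_cos_gt0.
Qed.

End RankOneCircle.

Lemma euclidean_distortion_ge (R : realType) (r n : nat) :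
  (2 <= r)%N -> (2 <= n)%N ->
  ((Num.sqrt 2)%:E <= euclidean_distortion (@quot_dist R r n))%E.
Proof.
move=> r2 n2; apply: le_ereal_inf_tmp => _ [H [ip [f [ipE <-]]]].
apply: (@circle_distortion R r n (Ordinal (ltnW r2)) (Ordinal r2)
  (Ordinal (ltnW n2)) (Ordinal n2)) ipE => //.
Qed.

Theorem theorem20 (R : realType) (r n : nat)
    (r_ge1 : (1 <= r)%N) (r_le_n : (r <= n)%N) :
  (distortion (@quot_dist R r n) (@cod_dist R r n) (@F R r n)
     <= (2 * Num.sqrt 2)%:E)%E /\
  ((2 <= r)%N ->
    ((Num.sqrt 2)%:E <= euclidean_distortion (@quot_dist R r n))%E /\
    (euclidean_distortion (@quot_dist R r n) <= (2 * Num.sqrt 2)%:E)%E).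
Proof.
split=> [|r_ge2]; first exact: F_distortion.
split; last exact: euclidean_distortion_le.
exact: euclidean_distortion_ge (leq_trans r_ge2 r_le_n).
Qed.
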